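(* Consider the weighted 2-spanner problem. For any distributed algorithm, even in the LOCAL model (and even randomized), that obtains a constant or a polylogarithmic approximation ratio, there are graphs on which it requires at least $\Omega\!\left(\frac{\log\Delta}{\log\log\Delta}\right)$ rounds and graphs on which it requires $\Omega\!\left(\sqrt{\frac{\log n}{\log\log n}}\right)$ rounds, where $n$ is the number of vertices and $\Delta$ the maximum degree.
   Context: Weighted 2-spanner problem: the input is a connected undirected graph $G=(V,E)$ with non-negative edge weights $w(e)$ (all edges have length 1). A subgraph $H\subseteq E$ is a 2-spanner if for every edge $\{u,v\}\in E$ there is a path with at most 2 edges between $u$ and $v$ in $H$; the goal is to minimize $w(H)=\sum_{e\in H}w(e)$. Distributed setting: the input graph is the communication network; vertices have unique IDs and initially know their incident edges and weights; synchronous rounds; each vertex outputs a subset of its incident edges. In the LOCAL model messages have unbounded size. *)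

(* Defs.v *)
From HB Require Import structures.
From mathcomp Require Import all_boot all_order all_algebra.
From mathcomp Require Import all_classical all_reals all_analysis.

Set Implicit Arguments.
Unset Strict Implicit.
Unset Printing Implicit Defensive.

Import Order.TTheory GRing.Theory Num.Theory.

Local Open Scope ring_scope.

(* The finset and classical_sets notations overlap; everything below is in
   finset notation except where %classic is explicit. *)
Local Open Scope set_scope.

(* An undirected edge is a two-element set of vertices. *)
Record network (R : realType) := Network {
  vertex : finType;
  edges : {set {set vertex}};
  weight : {set vertex} -> R;
  ident : vertex -> nat;
  edges_card2 : forall e, e \in edges -> #|e| = 2%N;
  weight_ge0 : forall e, e \in edges -> 0 <= weight e;
  ident_inj : injective ident;
  network_connected :
    forall u v, connect [rel x y | [set x; y] \in edges] u v
}.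

Section Spanners.
Context {R : realType} (G : network R).

Definition adj : rel (vertex G) := [rel u v | [set u; v] \in edges G].

Definition num_vertices : nat := #|vertex G|.

Definition max_degree : nat := (\max_(v : vertex G) #|[set u | adj v u]|)%N.

Definition total_weight (H : {set {set vertex G}}) : R :=
  \sum_(e in H) weight e.

Definition is_2spanner (H : {set {set vertex G}}) : Prop :=
  H \subset edges G /\
  forall u v, adj u v ->
    exists p : seq (vertex G),
      [/\ path [rel x y | [set x; y] \in H] u p, last u p = v
        & (size p <= 2)%N].

(* The minimum weight of a 2-spanner; the default value of the minimum is
   harmless because [edges G] is itself a 2-spanner. *)
Definition opt_2spanner : R :=
  \big[Order.min/total_weight (edges G)]_(H : {set {set vertex G}}
     | `[< is_2spanner H >]) total_weight H.

End Spanners.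

Section Independence.
Local Open Scope classical_set_scope.

Definition mutually_independent {R : realType} {d d' : measure_display}
    {Omega : measurableType d} {S : measurableType d'}
    (P : probability Omega R) (X : nat -> Omega -> S) : Prop :=
  forall (s : seq nat) (B : nat -> set S),
    uniq s -> (forall i, measurable (B i)) ->
    P (\big[setI/setT]_(i <- s) (X i @^-1` B i)) =
      (\prod_(i <- s) P (X i @^-1` B i))%E.

End Independence.

(* A randomized synchronous message-passing algorithm in the LOCAL model:
   the state space, the message space and the local computations are
   unrestricted.
   - [coin i] is the private randomness of the vertex with identifier [i]; it
     takes values in an arbitrary space, so it may encode all the random choices
     made during an execution.  Deterministic algorithms have constant coins.
   - [init n D i w c] is the initial state of the vertex with identifier [i] and
     private randomness [c] in a network with [n] vertices and maximum degree
     [D]; [w j] is [Some x] if there is an edge of weight [x] to the vertex with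
     identifier [j], and [None] otherwise.  An algorithm without knowledge
     of [n] and [D] ignores the first two arguments.
   - [send s j] is the message for the neighbour with identifier [j].
   - [recv s m] is the next state, where [m j] is the message received from the
     neighbour with identifier [j], if there is one.
   - [output s] is [None] as long as the vertex has not produced an output;
     [Some o] stands for the set of incident edges whose other endpoint has an
     identifier in [o].  An output cannot be revoked, but its vertex may go on
     relaying messages. *)
Record algorithm (R : realType) := Algorithm {
  sample_display : measure_display;
  sample : measurableType sample_display;
  prob : probability sample R;
  seed_display : measure_display;
  seed : measurableType seed_display;
  coin : nat -> {RV prob >-> seed};
  coin_independent : mutually_independent prob (fun i => coin i);
  state : Type;
  message : Type;
  init : nat -> nat -> nat -> (nat -> option R) -> seed -> state;
  send : state -> nat -> message;
  recv : state -> (nat -> option message) -> state;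
  output : state -> option (pred nat);
  output_irrevocable : forall s m o,
    output s = Some o -> output (recv s m) = Some o
}.

Section Execution.
Context {R : realType} (A : algorithm R) (G : network R).

Definition neighbor (v : vertex G) (i : nat) : option (vertex G) :=
  [pick u | adj v u & ident u == i].

Definition incident_weights (v : vertex G) : nat -> option R :=
  fun i => omap (fun u => weight [set v; u]) (neighbor v i).

Definition init_state (w : sample A) (v : vertex G) : state A :=
  init (num_vertices G) (max_degree G) (ident v) (incident_weights v)
    (coin A (ident v) w).

Definition inbox (st : vertex G -> state A) (v : vertex G) :
    nat -> option (message A) :=
  fun i => omap (fun u => send (st u) (ident v)) (neighbor v i).

Fixpoint run (w : sample A) (t : nat) : vertex G -> state A :=
  if t is t'.+1 then
    let st := run w t' in fun v => recv (st v) (inbox st v)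
  else init_state w.

Definition terminated (st : vertex G -> state A) : bool :=
  [forall v, output (st v)].

Definition selects (st : vertex G -> state A) (u v : vertex G) : bool :=
  adj u v && odflt (fun _ => false) (output (st u)) (ident v).

Definition output_edges (st : vertex G -> state A) : {set {set vertex G}} :=
  [set [set u; v] | u in vertex G, v in vertex G & selects st u v].

Definition good_outcome (alpha : R) (st : vertex G -> state A) : Prop :=
  [/\ terminated st, is_2spanner (output_edges st)
    & total_weight (output_edges st) <= alpha * opt_2spanner G].

(* Within [t] rounds, [A] computes an [alpha]-approximation on [G] with
   probability at least 2/3.  The local computations need not be measurable,
   hence the inner probability. *)
Definition approximates_within (alpha : R) (t : nat) : Prop :=
  exists E : set (sample A),
    [/\ measurable E, (E `<=` [set w | good_outcome alpha (run w t)])%classic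
      & ((2 / 3)%:E <= prob A E)%E].

Definition requires_rounds (alpha : R) (r : R) : Prop :=
  forall t : nat, approximates_within alpha t -> r <= t%:R.

End Execution.

Definition has_approximation_ratio {R : realType} (A : algorithm R)
    (alpha : nat -> R) : Prop :=
  forall G : network R,
    exists t, approximates_within A G (alpha (num_vertices G)) t.

(* At most polylogarithmic; the exponent 0 covers constant ratios. *)
Definition polylogarithmic {R : realType} (alpha : nat -> R) : Prop :=
  exists (c : nat) (C : R),
    (\forall n \near \oo, alpha n <= C * ln n%:R ^+ c)%classic.

(* Main.v *)
(** The proof of Kuhn, Moscibroda and Wattenhofer, on weighted gadget graphs.

    Fix [k] and a large [delta].  In the cluster tree every complete cluster has
    one neighbouring cluster for each label [i <= k], towards which its vertices
    have degree [delta ^ i]; a child reached through label [i] sees its parent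
    through label [i + 1], so it is [delta] times smaller.  The root cluster is
    thus an independent set that contains almost all vertices.  On the other
    hand, the root and its child through label [0] have bisimilar neighbourhoods
    up to depth [k - 1].  In a graph of girth more than [2 k] with these degrees,
    balls are trees, so a bisimulation yields a permutation [pi] of the vertices
    that is an isomorphism between the balls around two adjacent vertices [x]
    and [y] of these clusters.

    A weighted gadget makes 2-spanners of small weight encode vertex covers.  Fix
    the coins: composition with [pi] is a bijection between the assignments of
    identifiers, so within fewer than [k - 1] rounds [x] and [y] enter the cover
    for the same number of assignments.  Since one of them must be in the cover
    whenever the output is correct, a constant fraction of the root cluster is
    covered for some assignment, while the complement of the root cluster is a
    much cheaper cover.

    The graphs of large girth are lifts: over a field [F] of characteristic 2,
    the vertex [(x, M)], with [M] a 2x2 matrix over [F[X]/X^(N+1)] whose constant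
    term is the identity, is joined to [(y, M * (1 + X A))] where [A] is a
    nilpotent matrix of rank one that depends on the edge [xy].  The product of
    the matrices [A] along a reduced walk does not vanish, hence no reduced walk
    of length at most [N] is closed.  The lift has only [#|F| ^ O(N)] times as
    many vertices as the base graph, which is what the second bound needs. *)
Require Import Defs.
From mathcomp Require Import all_boot all_order all_algebra.
From mathcomp Require Import all_fingroup all_field.
From mathcomp Require Import all_classical all_reals all_analysis.
From mathcomp Require Import measurable_realfun zify ring lra.

Set Implicit Arguments.
Unset Strict Implicit.
Unset Printing Implicit Defensive.

Import Order.TTheory GRing.Theory Num.Theory.

Local Open Scope set_scope.

(** * The cluster tree *)

Section ClusterTree.
Context (k : nat).

(* A cluster is the list of the labels on the path from the root to it, the last
   label first. *)
Fixpoint radius (c : seq nat) : nat :=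
  if c is i :: p then minn (radius p).-1 (k - i) else k.

Definition cluster_nbr (c : seq nat) (i : nat) : option (seq nat) :=
  if (0 < size c) && (i == (head 0 c).+1) then Some (behead c)
  else if (0 < radius c) && (i <= k) then Some (i :: c) else None.

Fixpoint is_cluster (c : seq nat) : bool :=
  if c is i :: p then is_cluster p && (cluster_nbr p i == Some c) else true.

(** Label [k + 1] is included because a leaf reached through label [k] sees its parent there. *)
Fixpoint bisim (t : nat) (c d : seq nat) : bool :=
  if t is t'.+1 then
    [forall i : 'I_k.+2,
      match cluster_nbr c i, cluster_nbr d i with
      | Some a, Some b => bisim t' a b
      | None, None => true
      | _, _ => false
      end]
  else true.

Lemma bisim_refl t c : bisim t c c.
Proof.
elim: t c => //= t IHt c; apply/forallP => i.
by case: (cluster_nbr c i).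
Qed.

Lemma bisim_sym t c d : bisim t c d -> bisim t d c.
Proof.
elim: t c d => //= t IHt c d /forallP cd; apply/forallP => i; move: (cd i).
by case: (cluster_nbr c i) (cluster_nbr d i) => [a|] [b|] //; exact: IHt.
Qed.

Lemma bisim_trans t c d f : bisim t c d -> bisim t d f -> bisim t c f.
Proof.
elim: t c d f => //= t IHt c d f /forallP cd /forallP df; apply/forallP => i.
move: (cd i) (df i); case: (cluster_nbr c i) => [a|];
  case: (cluster_nbr d i) => [b|] //; case: (cluster_nbr f i) => [x|] //.
exact: IHt.
Qed.

Lemma bisimS t c d : bisim t.+1 c d -> bisim t c d.
Proof.
elim: t c d => // t IHt c d /forallP cd; apply/forallP => i; move: (cd i).
case: (cluster_nbr c i) => [a|]; case: (cluster_nbr d i) => [b|] //.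
exact: IHt.
Qed.

Lemma is_cluster_cons i p :
  is_cluster (i :: p) ->
  [/\ is_cluster p, 0 < radius p, i <= k
    & ~~ ((0 < size p) && (i == (head 0 p).+1))].
Proof.
move=> /= /andP[cp]; rewrite /cluster_nbr.
case: ifP => [_ /eqP[]|_].
  by move=> /(congr1 size); rewrite size_behead /=; lia.
by case: ifP => // /andP[-> ->].
Qed.

(** Upwards the hypothesis on the parents applies, one level shallower. Downwards both clusters have
    children for the same labels, again of equal radius, so the induction covers them. *)
Lemma bisim_siblings t i p q :
  radius (i :: p) = radius (i :: q) -> bisim t.-1 p q ->
  bisim t (i :: p) (i :: q).
Proof.
elim: t i p q => // t IHt i p q rpq bpq; apply/forallP => j.
rewrite /cluster_nbr [head _ _]/= [head _ _]/= [size _]/= [size _]/=.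
rewrite !andTb rpq.
case: ifP => _; first exact: bpq.
case: ifP => // _; apply: (IHt); first by move: rpq => /= ->.
have : bisim t (i :: p) (i :: q).
  by apply: IHt => //; case: (t) bpq => //= t'; exact: bisimS.
by case: (t) => //= t'; exact: bisimS.
Qed.

(* A neighbour through label i is complete only up to radius k - i; beyond that
   the two neighbours are children with isomorphic subtrees. *)
Lemma bisim_radius t c d : is_cluster c -> is_cluster d ->
  t <= radius c -> t <= radius d -> bisim t c d.
Proof.
elim: t c d => // t IHt c d wc wd rc rd; apply/forallP => i.
have nbrP x : is_cluster x -> t < radius x ->
    (exists p j, [/\ x = j :: p, i = j.+1 :> nat & cluster_nbr x i = Some p]) \/
    (cluster_nbr x i = if i <= k then Some (nat_of_ord i :: x) else None).
  move=> wx rx; rewrite /cluster_nbr (leq_trans _ rx) //=.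
  case: ifP => [|_]; last by right.
  by case: x {wx rx} => //= j p /eqP->; left; exists p, j.
have parentP j p : is_cluster (j :: p) -> t < radius (j :: p) ->
    [/\ is_cluster p, t < radius p & j.+1 + t <= k].
  move=> wx /= rx; have [-> rp _ _] := is_cluster_cons wx.
  by split=> //; lia.
have childP x : is_cluster x -> t < radius x ->
    cluster_nbr x i = Some (nat_of_ord i :: x) ->
    is_cluster (nat_of_ord i :: x).
  by move=> /= -> _ ->; rewrite eqxx.
case: (nbrP c wc rc) => [[p [j [cE ij ->]]]|nc];
  case: (nbrP d wd rd) => [[q [j' [dE ij' ->]]]|nd].
- subst c d; have [? ? ?] := parentP _ _ wc rc.
  by have [? ? ?] := parentP _ _ wd rd; apply: IHt => //; lia.
- subst c; have [? ? jk] := parentP _ _ wc rc.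
  have ik : i <= k by lia.
  rewrite ik in nd; rewrite nd; apply: IHt => //; [exact: childP | lia |].
  by rewrite /=; lia.
- subst d; have [? ? jk] := parentP _ _ wd rd.
  have ik : i <= k by lia.
  rewrite ik in nc; rewrite nc; apply: IHt => //; [exact: childP | | lia].
  by rewrite /=; lia.
- case: (leqP i k) => ik; last by rewrite nc nd leqNgt ik.
  rewrite ik in nc nd; rewrite nc nd.
  have [tki|kit] := leqP t (k - i).
    by apply: IHt; do 1?[exact: childP]; rewrite /=; lia.
  apply: bisim_siblings; first by rewrite /=; lia.
  case: t {parentP nbrP childP kit} IHt rc rd => // t IHt rc rd.
  by apply: bisimS; apply: IHt => //; lia.
Qed.

End ClusterTree.

(** * Lifts of large girth *)

Section Girth.
Context (V : eqType).

Fixpoint nonbacktracking (s : seq V) : bool :=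
  if s is x :: s' then
    (if s' is _ :: z :: _ then x != z else true) && nonbacktracking s'
  else true.

(** Closed walks without reversals replace cycles, so distinctness of vertices is never tracked. *)
Definition girth_gt (n : nat) (e : rel V) : Prop :=
  forall x p, path e x p -> nonbacktracking (x :: p) -> 0 < size p <= n ->
    last x p != x.

(** [catrev a (z :: b)] runs back along [a] from its end to [z], then along [b]; the third
    hypothesis excludes a reversal at [z]. *)
Lemma nonbacktracking_catrev z a b :
  nonbacktracking (z :: a) -> nonbacktracking (z :: b) ->
  (if a is x :: _ then if b is y :: _ then x != y else true else true) ->
  nonbacktracking (catrev a (z :: b)).
Proof.
elim: a z b => [//|x a IHa] z b nza nzb xb; apply: IHa.
- by case/andP: nza.
- by apply/andP; split=> //; case: b {nzb} xb.
- by case: a nza => //= y a /andP[]; rewrite eq_sym.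
Qed.

Lemma path_catrev (e : rel V) z a b : symmetric e -> path e z a -> path e z b ->
  sorted e (catrev a (z :: b)).
Proof.
move=> esym; elim: a z b => [//|x a IHa] z b /= /andP[zx xa] zb.
by apply: IHa => //=; rewrite esym zx.
Qed.

(** Common first steps are dropped. Where two walks part, one of them reversed and followed by the
    other is a short closed walk without reversals. *)
Lemma girth_gt_uniq n (e : rel V) z a b : symmetric e -> girth_gt n e ->
  path e z a -> path e z b -> nonbacktracking (z :: a) ->
  nonbacktracking (z :: b) -> last z a = last z b -> size a + size b <= n ->
  a = b.
Proof.
move=> esym girth; elim: a z b => [|x a IHa] z [|y b] //.
- move=> _ zb _ nzb lzb sb; move: (girth z (y :: b) zb nzb).
  by rewrite -lzb /= eqxx => /(_ sb).
- move=> za _ nza _ lza; rewrite addn0 => sa; move: (girth z (x :: a) za nza).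
  by rewrite lza /= eqxx => /(_ sa).
have [<-|xy] := eqVneq x y.
  move=> /= /andP[_ xa] /andP[_ xb] /andP[_ na] /andP[_ nb] lab sab.
  by congr (_ :: _); apply: (IHa x) => //; lia.
move=> za zb nza nzb lab sab.
have := nonbacktracking_catrev nza nzb xy.
have := path_catrev esym za zb.
have szc : size (catrev (x :: a) (z :: y :: b)) = (size a + size b).+3.
  by rewrite catrevE size_cat size_rev /=; lia.
have hdc : head z (catrev (x :: a) (z :: y :: b)) = last z (x :: a).
  by rewrite catrevE; case/lastP: a {IHa za nza lab sab szc} => //= a x';
    rewrite last_rcons !rev_cons rev_rcons.
have lsc : last z (catrev (x :: a) (z :: y :: b)) = last z (x :: a).
  by rewrite catrevE last_cat lab.
case: catrev szc hdc lsc => //= h t [szt] hE lE pt nt.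
have /negP[] : last h t != h by apply: girth => //; move: sab => /=; lia.
by case: t lE szt {pt nt} => //= ? ? ->; rewrite hE.
Qed.

End Girth.

Section GirthLift.
Local Open Scope ring_scope.
Context (F : finFieldType) (F2 : 2%N \in [pchar F]).
Context (H : finType) (e : rel H) (iota : H -> F) (N : nat).
Hypothesis iota_inj : injective iota.
Hypothesis e_sym : symmetric e.

(* [M i] is the coefficient of [X^(i + 1)]; the constant coefficient is 1. *)
Definition lift_group := {ffun 'I_N -> 'M[F]_2}.

Definition lift_poly (M : lift_group) : {poly 'M[F]_2} :=
  1 + 'X * \poly_(j < N) (if insub j is Some i then M i else 0).

(** The column [(1, a)] times the row [(b, 1)]. The row [(b, 1)] times the column [(1, c)] is
    [b + c], so [outer a a] squares to 0 in characteristic 2. *)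
Definition outer (a b : F) : 'M[F]_2 :=
  (\col_(i < 2) (if i == 0 then 1 else a)) *m
  (\row_(j < 2) (if j == 0 then b else 1)).

(** Right multiplication by [1 + X * outer a a], truncated after degree [N]. *)
Definition lift_act (a : F) (M : lift_group) : lift_group :=
  [ffun j : 'I_N =>
    (lift_poly M)`_j.+1 + (lift_poly M)`_j * outer a a].

Definition lift_rel : rel (H * lift_group) :=
  [rel u v | e u.1 v.1 && (v.2 == lift_act (iota u.1 + iota v.1) u.2)].

Lemma outerM a b c d : outer a b * outer c d = (b + c) *: outer a d.
Proof.
rewrite -[LHS]/(outer a b *m outer c d) /outer -mulmxA (mulmxA (\row_j _)).
set s := (\row_j _ *m _).
have -> : s = (b + c)%:M.
  apply/matrixP => i j; rewrite !ord1 !mxE !big_ord_recl big_ord0 !mxE /=.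
  by rewrite mulr1 mul1r addr0 mulr1n.
by rewrite mul_scalar_mx -scalemxAr.
Qed.

Lemma outer_neq0 a b : outer a b != 0.
Proof.
apply/eqP => /matrixP /(_ 0 (lift 0 0)).
rewrite !mxE big_ord1 !mxE /= mulr1.
by move/eqP; rewrite oner_eq0.
Qed.

Lemma lift_poly0 M : (lift_poly M)`_0 = 1.
Proof. by rewrite coefD coefXM eqxx coef1 addr0. Qed.

Lemma lift_polyS M (j : 'I_N) : (lift_poly M)`_j.+1 = M j.
Proof. by rewrite coefD coefXM coef1 /= add0r coef_poly ltn_ord valK. Qed.

Definition step_poly (a : F) : {poly 'M[F]_2} := 1 + (outer a a)%:P * 'X.

Lemma lift_poly_act a M j : (j <= N)%N ->
  (lift_poly (lift_act a M))`_j = (lift_poly M * step_poly a)`_j.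
Proof.
rewrite /step_poly mulrDr mulr1 mulrA [RHS]coefD coefMX coefMC.
case: j => [|j] jN; first by rewrite !lift_poly0 eqxx addr0.
by rewrite (lift_polyS _ (Ordinal jN)) ffunE.
Qed.

Lemma lift_group_eq (M M' : lift_group) :
  (forall j, (j <= N)%N -> (lift_poly M)`_j = (lift_poly M')`_j) -> M = M'.
Proof.
by move=> eqM; apply/ffunP => j; rewrite -!lift_polyS; apply: eqM.
Qed.

Lemma coefM_congr n (p q r : {poly 'M[F]_2}) :
  (forall j, (j <= n)%N -> p`_j = q`_j) ->
  forall j, (j <= n)%N -> (p * r)`_j = (q * r)`_j.
Proof.
move=> pq j jn; rewrite !coefM; apply: eq_bigr => i _.
by rewrite pq // (leq_trans _ jn) // -ltnS ltn_ord.
Qed.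

(** The square and the double of the nilpotent part both vanish. Hence [lift_act a] is an involution
    and the lift is undirected. *)
Lemma step_poly_sqr a : step_poly a * step_poly a = 1.
Proof.
have char2 (x : F) : x + x = 0.
  by rewrite -mulr2n -mulr_natr (pcharf0 F2) mulr0.
rewrite /step_poly; set u := _ * 'X.
have uu0 : u * u = 0.
  rewrite /u -mulrA (mulrA 'X) -(commr_polyX (outer a a)%:P) !mulrA -polyCM.
  by rewrite outerM char2 scale0r !mul0r.
have u2 : u + u = 0.
  rewrite /u -mulrDl -polyCD; have -> : outer a a + outer a a = 0.
    by rewrite -[X in X + X]scale1r -scalerDl char2 scale0r.
  by rewrite mul0r.
by rewrite mulrDr mulr1 mulrDl mul1r uu0 addr0 -addrA u2 addr0.
Qed.

Lemma lift_actK a : involutive (lift_act a).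
Proof.
move=> M; apply: lift_group_eq => j jN.
rewrite lift_poly_act // (@coefM_congr N _ (lift_poly M * step_poly a)) //.
  by rewrite -mulrA step_poly_sqr mulr1.
exact: lift_poly_act.
Qed.

Lemma lift_rel_sym : symmetric lift_rel.
Proof.
suff imp : forall u v, lift_rel u v -> lift_rel v u.
  by move=> u v; apply/idP/idP; exact: imp.
move=> [x M] [y M'] /andP[/= exy /eqP->].
by rewrite /lift_rel /= e_sym exy addrC lift_actK eqxx.
Qed.

Fixpoint walk_poly (x : H) (p : seq H) : {poly 'M[F]_2} :=
  if p is y :: p' then step_poly (iota x + iota y) * walk_poly y p' else 1.

Fixpoint walk_outer (x : H) (p : seq H) : 'M[F]_2 :=
  if p is y :: p' then
    outer (iota x + iota y) (iota x + iota y) * walk_outer y p'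
  else 1.

Lemma walk_poly_top x p :
  (walk_poly x p)`_(size p) = walk_outer x p /\
  (forall j, (size p < j)%N -> (walk_poly x p)`_j = 0).
Proof.
elim: p x => [|y p IHp] x /=.
  by split=> [|j]; rewrite coef1 //; case: j.
have [IHt IH0] := IHp y.
split=> [|j pj]; rewrite /step_poly mulrDl mul1r coefD -mulrA -commr_polyX
    mulrA coefMX coefCM.
  by rewrite IHt IH0 // add0r.
by case: j pj => // j pj; rewrite !IH0 ?mulr0 ?addr0 // ltnW.
Qed.

(** Consecutive edges [xy] and [yz] contribute the factor [iota x + iota z], nonzero in
    characteristic 2 since [x != z] and [iota] is injective. *)
Lemma walk_outer_neq0 x y p : nonbacktracking (x :: y :: p) ->
  exists c b,
    c != 0 /\ (walk_outer x (y :: p) = c *: outer (iota x + iota y) b).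
Proof.
elim: p x y => [|z p IHp] x y /=.
  by move=> _; exists 1, (iota x + iota y); rewrite oner_eq0 mulr1 scale1r.
move=> /andP[xz nyz]; have [c [b [c0 /= ->]]] := IHp y z nyz.
exists (c * (iota x + iota y + (iota y + iota z))), b; split.
  have char2 (t : F) : t + t = 0.
    by rewrite -mulr2n -mulr_natr (pcharf0 F2) mulr0.
  rewrite mulf_neq0 // addrA -(addrA (iota x)) char2 addr0.
  apply: contra_neq xz => /eqP; rewrite addr_eq0 => /eqP xz.
  apply: iota_inj; rewrite xz; apply/eqP.
  by rewrite eq_sym -subr_eq0 opprK char2.
by rewrite -scalerAr outerM scalerA.
Qed.

Lemma lift_walk_poly u p j : path lift_rel u p -> (j <= N)%N ->
  (lift_poly (last u p).2)`_j =
  (lift_poly u.2 * walk_poly u.1 [seq v.1 | v <- p])`_j.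
Proof.
move=> up jN; elim: p u up => [|v p IHp] u /=; first by rewrite mulr1.
move=> /andP[/andP[_ /eqP vE] vp]; rewrite (IHp v) // mulrA.
apply: (@coefM_congr N) => // i iN; rewrite vE; exact: lift_poly_act.
Qed.

(** If the projection turned back along an edge, the involution would restore the second coordinate
    too, and the lifted walk would turn back as well. *)
Lemma lift_walk_nonbacktracking u p : path lift_rel u p ->
  nonbacktracking (u :: p) -> nonbacktracking [seq v.1 | v <- u :: p].
Proof.
elim: p u => [//|v p IHp] u /andP[uv vp] /andP[uw nv].
apply/andP; split; last exact: IHp.
case: p vp uw {IHp nv} => // w p /andP[vw _]; apply: contra_neq => uw1.
move: uv vw => /andP[_ /eqP vE] /andP[_ /eqP wE].
apply: injective_projections => //.
by rewrite wE vE -uw1 addrC lift_actK.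
Qed.

(** A closed walk gives [M * W = M] up to degree [N], where [W] is the product of its steps. Then
    [W] agrees with 1 up to degree [N], although its coefficient at the length of the walk is a
    nonzero matrix. *)
Lemma lift_girth : girth_gt N lift_rel.
Proof.
move=> u p up nup /andP[p0 pN]; apply/eqP => lu.
have nq := lift_walk_nonbacktracking up nup.
set q := [seq v.1 | v <- p]; have sq : size q = size p by rewrite size_map.
pose D := walk_poly u.1 q - 1.
have MD j : (j <= N)%N -> (lift_poly u.2 * D)`_j = 0.
  by move=> jN; rewrite mulrBr mulr1 coefB -lift_walk_poly // lu subrr.
(* Cancels [lift_poly u.2], whose constant term is 1, by induction on the degree. *)
have D0 j : (j <= N)%N -> D`_j = 0.
  elim/ltn_ind: j => j IHj jN; have := MD j jN.
  rewrite coefM big_ord_recl lift_poly0 mul1r subn0 big1 ?addr0 //.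
  move=> i _; rewrite IHj ?mulr0 //= /bump /=; have := ltn_ord i; lia.
have := D0 (size q); rewrite sq pN coefB coef1 -sq eqn0Ngt sq p0 subr0 -sq.
move=> /(_ isT); rewrite (walk_poly_top _ _).1.
have {}nq : nonbacktracking (u.1 :: q) := nq.
case E : q => [|y q']; first by move: p0; rewrite -sq E.
have [c [b [c0 ->]]] : exists c b, c != 0 /\
    (walk_outer u.1 (y :: q') = c *: outer (iota u.1 + iota y) b).
  by apply: walk_outer_neq0; rewrite -E.
move/eqP; rewrite scaler_eq0 (negbTE c0) /=.
by rewrite (negbTE (outer_neq0 _ _)).
Qed.

(** The lift is a covering: the neighbours of a vertex project bijectively, so all prescribed
    degrees carry over. *)
Lemma card_lift_nbrs (u : H * lift_group) (P : pred H) :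
  #|[set v | lift_rel u v & P v.1]| = #|[set y | e u.1 y & P y]|.
Proof.
pose f y := (y, lift_act (iota u.1 + iota y) u.2).
have -> : [set v | lift_rel u v & P v.1] = f @: [set y | e u.1 y & P y].
  apply/finset.setP => -[y M]; rewrite inE /=; apply/idP/imsetP.
    move=> /andP[/andP[/= uy /eqP->] Py]; exists y => //.
    by rewrite inE uy.
  move=> [z]; rewrite inE => /andP[uz Pz] [-> ->].
  by rewrite /lift_rel /= uz eqxx.
by rewrite card_imset // => y z [].
Qed.

Lemma card_lift_group : #|{: lift_group}| = (#|F| ^ (4 * N))%N.
Proof. by rewrite card_ffun card_mx card_ord -expnM. Qed.

End GirthLift.

(** * Isomorphic views *)

(** Greedy pairing: removing equivalent elements from [A] and [B] keeps the class counts equal. *)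
Lemma class_matching (V : finType) (r : rel V) (A B : {set V}) :
  equivalence_rel r ->
  (forall z, #|[set y in A | r z y]| = #|[set y in B | r z y]|) ->
  exists g : V -> V, {in A &, injective g} /\
    {in A, forall z, g z \in B /\ r z (g z)}.
Proof.
move=> /equivalence_relP[rr rt]; move: {2}#|A| (erefl #|A|) => n.
elim: n A B => [|n IHn] A B.
  move=> /cards0_eq -> _; exists id.
  by split=> [? ?|?]; rewrite inE.
move=> cA cAB; have /card_gt0P[z zA] : 0 < #|A| by rewrite cA.
have : 0 < #|[set y in B | r z y]|.
  by rewrite -cAB; apply/card_gt0P; exists z; rewrite inE zA rr.
move=> /card_gt0P[w]; rewrite inE => /andP[wB rzw].
have rC u v : r u v = r v u by apply/idP/idP => /rt <-; rewrite rr.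
have [|u|g [gi gB]] := IHn (A :\ z) (B :\ w).
- by move: cA; rewrite (cardsD1 z) zA => -[].
- have cD1 (C : {set V}) x : x \in C ->
      #|[set y in C | r u y]| = (r u x) + #|[set y in C :\ x | r u y]|.
    move=> xC; rewrite (cardsD1 x) inE xC /=; congr (_ + #|pred_of_set _|).
    by apply/finset.setP => y; rewrite !inE andbA.
  apply/eqP; have := cAB u; rewrite (cD1 _ _ zA) (cD1 _ _ wB).
  by rewrite [r u z]rC [r u w]rC (rt _ _ rzw) => /addnI ->.
exists (fun u => if u == z then w else g u); split.
  move=> x y xA yA.
  have [->|xz] := eqVneq x z; have [->|yz] := eqVneq y z => //.
  - by have [|] := gB y; rewrite !inE ?yz // => /andP[/eqP gw _] _ /esym.
  - by have [|] := gB x; rewrite !inE ?xz // => /andP[/eqP gw _] _.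
  - by apply: gi; rewrite !inE ?xz ?yz.
move=> x xA; have [->//|xz] := eqVneq x z.
by have [|] := gB x; rewrite !inE ?xz // => /andP[_ ->].
Qed.

(** The complements of [D] and of its image have equal size, so [class_matching] for the trivial
    relation matches them. *)
Lemma perm_extension (V : finType) (D : {set V}) (f : V -> V) :
  {in D &, injective f} -> exists pi : {perm V}, {in D, pi =1 f}.
Proof.
move=> fi; have [||g [gi gB]] :=
    @class_matching V (fun _ _ => true) (~: D) (~: (f @: D)).
- by move=> x y z; split.
- move=> _; have trueT (C : {set V}) : [set y in C | true] = C.
    by apply/finset.setP => y; rewrite inE andbT.
  by rewrite !trueT; have := cardsC D; have := cardsC (f @: D);
    rewrite card_in_imset //; lia.
pose h x := if x \in D then f x else g x.
have hi : injective h.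
  move=> x y; rewrite /h; case: ifPn => xD; case: ifPn => yD.
  - exact: fi.
  - move=> fg; have [] := gB y; rewrite !inE // -fg => /negP[].
    exact: imset_f.
  - move=> fg; have [] := gB x; rewrite !inE // fg => /negP[].
    exact: imset_f.
  - by apply: gi; rewrite inE.
by exists (perm hi) => x xD; rewrite permE /h xD.
Qed.

(** * Isomorphism of balls around vertices of equal refined colour *)

Section ViewIsomorphism.
Context (V : finType) (e : rel V) (color : nat -> rel V) (R n : nat).
Hypothesis e_sym : symmetric e.
Hypothesis e_girth : girth_gt n e.
Hypothesis Rn : R.*2 <= n.
Hypothesis color_equiv : forall t, equivalence_rel (color t).
Hypothesis color0 : forall x y, color 0 x y.
Hypothesis colorS : forall t x y, color t.+1 x y -> color t x y.
Hypothesis color_count : forall t x y, color t.+1 x y -> forall z,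
  #|[set u | e x u & color t z u]| = #|[set u | e y u & color t z u]|.

Definition nbrs x := [set y | e x y].

(* Walks are stored backwards: the head is the current vertex. *)
Definition walk_ext (w : seq V) : {set V} :=
  if w is x :: w' then
    nbrs x :\: (if w' is y :: _ then [set y] else finset.set0)
  else finset.set0.

Definition is_walk (v : V) (w : seq V) : bool :=
  if w is x :: w' then
    [&& path e x w', nonbacktracking (x :: w') & last x w' == v]
  else false.

Definition is_matching t (A B : {set V}) (g : {ffun V -> V}) : bool :=
  [forall x in A, forall y in A, (g x == g y) ==> (x == y)] &&
  [forall x in A, (g x \in B) && color t x (g x)].

(** A fixed choice, so that walks with a common tail are extended by the same matching. The default
    is not reached when [A] and [B] have equal colour counts. *)
Definition matching t (A B : {set V}) : {ffun V -> V} :=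
  odflt [ffun x => x] [pick g | is_matching t A B g].

(** Transports a walk to one starting at [v]: first the tail, then the head through the matching of
    the possible extensions. Each step costs one level of colour. *)
Fixpoint walk_map (v : V) (w : seq V) : seq V :=
  if w is z :: w' then
    if w' is _ :: _ then
      matching (R - size w') (walk_ext w') (walk_ext (walk_map v w')) z
        :: walk_map v w'
    else [:: v]
  else [::].

Lemma color_refl t x : color t x x.
Proof. by have /equivalence_relP[-> _] := color_equiv t. Qed.

Lemma color_left t x y : color t x y -> color t x =1 color t y.
Proof. by have /equivalence_relP[_ +] := color_equiv t; apply. Qed.

Lemma color_sym t x y : color t x y = color t y x.
Proof.
by apply/idP/idP => /color_left <-; rewrite color_refl.
Qed.

Lemma color_le s t x y : s <= t -> color t x y -> color s x y.
Proof.
elim: t => [|t IHt]; first by rewrite leqn0 => /eqP->.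
by rewrite leq_eqVlt => /predU1P[->//|st] /colorS; exact: IHt.
Qed.

Lemma matchingP t (A B : {set V}) :
  (forall z, #|[set y in A | color t z y]| = #|[set y in B | color t z y]|) ->
  {in A &, injective (matching t A B)} /\
  {in A, forall z, matching t A B z \in B /\ color t z (matching t A B z)}.
Proof.
move=> cAB; rewrite /matching; case: pickP => [g|/= no_g].
  move=> /andP[/forall_inP gi /forall_inP gB].
  split=> [x y xA yA gxy|x /gB/andP//].
  have /forall_inP/(_ y yA) := gi x xA.
  by rewrite gxy eqxx => /eqP.
have [g [gi gB]] := class_matching (color_equiv t) cAB.
have /negP[] := negbT (no_g [ffun x => g x]); apply/andP; split.
  apply/forall_inP => x xA; apply/forall_inP => y yA; rewrite !ffunE.
  by apply/implyP => /eqP/gi ->.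
by apply/forall_inP => x /gB[]; rewrite ffunE => -> ->.
Qed.

(** The neighbourhoods agree colour by colour, and the excluded predecessors have the same
    colour. *)
Lemma count_walk_ext t x y a b : color t.+1 x y ->
  is_walk (last x a) (x :: a) -> is_walk (last y b) (y :: b) ->
  size a = size b -> color t (head x a) (head y b) ->
  forall z, #|[set u in walk_ext (x :: a) | color t z u]| =
            #|[set u in walk_ext (y :: b) | color t z u]|.
Proof.
move=> xy wa wb sab hab z.
have ext1 x' : [set u in walk_ext [:: x'] | color t z u] =
    [set u | e x' u & color t z u].
  by apply/finset.setP => u; rewrite !inE.
have ext2 x' p c : [set u in walk_ext (x' :: p :: c) | color t z u] =
    [set u | e x' u & color t z u] :\ p.
  by apply/finset.setP => u; rewrite !inE andbA.
have := color_count xy z; case: a b wa wb sab hab => [|p a] [|q b] //.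
  by rewrite !ext1.
rewrite !ext2 => /andP[/andP[xp _] _] /andP[/andP[yq _] _] _ /= pq.
rewrite (cardsD1 p) (cardsD1 q [set u | e y u & _]) !inE xp yq /=.
by rewrite color_sym (color_left pq) color_sym => /addnI.
Qed.

Lemma is_walk_tail v x y a : is_walk v (x :: y :: a) -> is_walk v (y :: a).
Proof. by case/and3P => /andP[_ ya] /andP[_ na] l; apply/and3P. Qed.

Lemma is_walk_last v x a : is_walk v (x :: a) -> is_walk (last x a) (x :: a).
Proof. by rewrite /is_walk => /and3P[-> -> _]; rewrite eqxx. Qed.

Lemma is_walk_cons v x a z : is_walk v (z :: x :: a) =
  is_walk v (x :: a) && (z \in walk_ext (x :: a)).
Proof.
case: a => [|y a]; rewrite /is_walk /walk_ext !inE (e_sym x z) /=.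
  by case: (e z x); rewrite ?andbF ?andbT.
case: (e z x); rewrite ?andbF //= andbT.
by case: (z != y); rewrite ?andbF ?andbT.
Qed.

(** The colour of the predecessors is part of the invariant because [count_walk_ext] needs it at the
    next extension. *)
Lemma walk_mapP v0 v1 z a : color R v0 v1 -> is_walk v0 (z :: a) ->
  size a <= R -> exists y b,
  [/\ walk_map v1 (z :: a) = y :: b, is_walk v1 (y :: b), size b = size a,
      color (R - size a) z y & color (R - size a) (head z a) (head y b)].
Proof.
move=> c01; elim: a z => [|x a IHa] z wa sa.
  exists v1, [::]; move: wa; rewrite /is_walk /= => /eqP->.
  by rewrite eqxx subn0.
have [|y [b [Eb wb sb cxy chd]]] := IHa x (is_walk_tail wa); first exact: ltnW.
move: wa; rewrite is_walk_cons => /andP[wa za].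
have t1 : R - size a = (R - (size a).+1).+1 by rewrite /= in sa; lia.
rewrite t1 in cxy chd; have [_ mB] := matchingP (count_walk_ext cxy
  (is_walk_last wa) (is_walk_last wb) (esym sb) (colorS chd)).
exists (matching (R - (size a).+1) (walk_ext (x :: a)) (walk_ext (y :: b)) z),
  (y :: b).
have [mz cz] := mB z za.
split=> //; [by rewrite -Eb | by rewrite is_walk_cons wb | by rewrite /= sb |].
exact: colorS.
Qed.

Lemma walk_map_inj v0 v1 w w' : color R v0 v1 -> is_walk v0 w ->
  is_walk v0 w' -> size w <= R.+1 -> size w' <= R.+1 ->
  walk_map v1 w = walk_map v1 w' -> w = w'.
Proof.
move=> c01; elim: w w' => [//|z a IHa] [//|z' a'] wz wz' sa sa' Ewz.
case: a IHa wz sa Ewz => [|x a] IHa wz sa Ewz.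
  case: a' wz' sa' Ewz => [|x' a'] wz' sa' Ewz.
    by move: wz wz'; rewrite /is_walk /= => /eqP-> /eqP->.
  have [y [b [Eb _ _ _ _]]] := walk_mapP c01 (is_walk_tail wz') (ltnW sa').
  by move: Ewz => /= -[_]; rewrite -/(walk_map v1 (x' :: a')) Eb.
case: a' wz' sa' Ewz => [|x' a'] wz' sa' Ewz.
  have [y [b [Eb _ _ _ _]]] := walk_mapP c01 (is_walk_tail wz) (ltnW sa).
  by move: Ewz => /= -[_]; rewrite -/(walk_map v1 (x :: a)) Eb.
have EwT : walk_map v1 (x :: a) = walk_map v1 (x' :: a') by case: Ewz.
have Exa := IHa _ (is_walk_tail wz) (is_walk_tail wz') (ltnW sa) (ltnW sa') EwT.
rewrite -Exa in wz' sa' Ewz *; congr (_ :: _).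
have [y [b [Eb wb sb cxy chd]]] := walk_mapP c01 (is_walk_tail wz) (ltnW sa).
have t1 : R - size a = (R - (size a).+1).+1 by rewrite /= in sa; lia.
move: wz wz'; rewrite !is_walk_cons => /andP[wa za] /andP[_ za'].
rewrite t1 in cxy chd; have [mi _] := matchingP (count_walk_ext cxy
  (is_walk_last wa) (is_walk_last wb) (esym sb) (colorS chd)).
apply: mi => //; move: Ewz; rewrite -Eb /=.
by case.
Qed.

Lemma walk_uniq v z a b : is_walk v (z :: a) -> is_walk v (z :: b) ->
  size a <= R -> size b <= R -> a = b.
Proof.
move=> /and3P[pa na /eqP la] /and3P[pb nb /eqP lb] sa sb.
apply: (girth_gt_uniq e_sym e_girth pa pb na nb); first by rewrite la lb.
by rewrite (leq_trans _ Rn) // -addnn leq_add.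
Qed.

Lemma path_walk v p : path e v p ->
  exists2 a, is_walk v (last v p :: a) & size a <= size p.
Proof.
elim/last_ind: p => [_|p z IHp]; first by exists [::]; rewrite //= eqxx.
rewrite rcons_path last_rcons size_rcons => /andP[/IHp[a wa sa] xz].
have [zext|] := boolP (z \in walk_ext (last v p :: a)).
  by exists (last v p :: a) => //; rewrite is_walk_cons wa.
rewrite !inE xz andbT negbK; case: a wa sa => [|y a] wa sa; rewrite !inE //.
move=> /eqP->; exists a; first exact: is_walk_tail wa.
by rewrite /= in sa; lia.
Qed.

(** Each vertex within distance [R] ends exactly one walk without reversals of length at most [R],
    as [R.*2 <= n]. Sending it to the end of the image walk is injective on the ball, and this
    injection extends to a permutation. *)
Theorem view_isomorphism v0 v1 : color R v0 v1 ->
  exists pi : {perm V}, pi v0 = v1 /\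
    forall p, path e v0 p -> size p < R ->
      nbrs (pi (last v0 p)) = pi @: nbrs (last v0 p).
Proof.
move=> c01.
pose f z := if [pick w : R.+1.-bseq V | is_walk v0 w && (head v0 w == z)]
  is Some w then head v1 (walk_map v1 w) else v1.
have fE z a : is_walk v0 (z :: a) -> size a <= R ->
    f z = head v1 (walk_map v1 (z :: a)).
  move=> wa sa; rewrite /f; case: pickP => [w|noW]; last first.
    have /negP[] := negbT (noW (Bseq (sa : size (z :: a) <= R.+1))).
    by apply/andP; split; [exact: wa | exact: eqxx].
  case: w => -[|x b] // sb /andP[wb]; rewrite [head _ _]/= => /eqP xz.
  rewrite [bseqval _]/= xz in wb *.
  by rewrite (walk_uniq wa wb sa sb).
pose D := [set z | [exists w : R.+1.-bseq V, is_walk v0 w && (head v0 w == z)]].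
have DP z : reflect (exists2 a, is_walk v0 (z :: a) & size a <= R) (z \in D).
  rewrite inE; apply: (iffP existsP) => [[[[//|x a] sa] /andP[wa /= /eqP xz]]|].
    by exists a => //; rewrite -xz.
  move=> [a wa sa]; exists (Bseq (sa : size (z :: a) <= R.+1)).
  by apply/andP; split; [exact: wa | exact: eqxx].
have fi : {in D &, injective f}.
  move=> z z' /DP[a wa sa] /DP[a' wa' sa'].
  rewrite (fE z a) // (fE z' a') //.
  have [y [b [Eb wb sb _ _]]] := walk_mapP c01 wa sa.
  have [y' [b' [Eb' wb' sb' _ _]]] := walk_mapP c01 wa' sa'.
  rewrite Eb Eb' /= => yy'; rewrite yy' in Eb wb.
  have bb' : b = b' by apply: (walk_uniq wb wb'); lia.
  have : z :: a = z' :: a'.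
    by apply: (walk_map_inj c01 wa wa') => //; rewrite Eb Eb' bb'.
  by case.
have [pi piE] := perm_extension fi; exists pi; split.
  have w0 : is_walk v0 [:: v0] by rewrite /= eqxx.
  by rewrite piE ?(fE v0 [::]) //; apply/DP; exists [::].
move=> p p0 sp; have [a wa sa] := path_walk p0; set x := last v0 p in wa *.
have {}sa : size a < R by exact: leq_ltn_trans sp.
have xD : x \in D by apply/DP; exists a => //; exact: ltnW.
have [y [b [Eb wb sb cxy _]]] := walk_mapP c01 wa (ltnW sa).
have pix : pi x = y by rewrite piE // (fE x a) // ?(ltnW sa) // Eb.
have cnbrs : #|nbrs x| = #|nbrs y|.
  have c1 : color 1 x y by apply: color_le cxy; lia.
  have nE u : [set v | e u v & color 0 x v] = nbrs u.
    by apply/finset.setP => v; rewrite !inE color0 andbT.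
  by have := color_count c1 x; rewrite !nE.
(* The degrees are equal, so one inclusion suffices. A neighbour of [x] either extends the walk to
   [x] or is its predecessor. *)
rewrite pix; apply/esym/eqP; rewrite eqEcard card_imset; last exact: perm_inj.
rewrite cnbrs leqnn andbT; apply/fintype.subsetP => _ /imsetP[z zx ->].
have [zext|] := boolP (z \in walk_ext (x :: a)).
  have wz : is_walk v0 (z :: x :: a) by rewrite is_walk_cons wa.
  have zD : z \in D by apply/DP; exists (x :: a).
  rewrite piE // (fE z (x :: a)) //.
  have [y' [b' [Eb' wb' _ _ _]]] := walk_mapP c01 wz sa.
  rewrite Eb' /=; have Ebb : b' = y :: b by rewrite -Eb; case: Eb'.
  by move: wb'; rewrite Ebb is_walk_cons => /andP[_]; rewrite !inE => /andP[].
move: zx; rewrite !inE => -> ; rewrite andbT negbK.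
case: a wa sa Eb sb {cxy} => [|z' a] wa sa Eb sb; rewrite !inE // => /eqP zE.
rewrite {}zE; have wz := is_walk_tail wa.
have z'D : z' \in D by apply/DP; exists a => //; rewrite /= in sa; lia.
have sa' : size a <= R by rewrite /= in sa; lia.
rewrite piE // (fE z' a) //.
have [y' [b' [Eb' wb' _ _ _]]] := walk_mapP c01 wz sa'.
rewrite Eb' /=; have Ebb : b = y' :: b' by rewrite -Eb'; case: Eb.
by move: wb; rewrite Ebb => /and3P[/andP[]].
Qed.

End ViewIsomorphism.

(** * The base graph *)

Section BaseGraph.
Context (k delta : nat).
Hypothesis delta_gt0 : 0 < delta.

Lemma size_cluster c : is_cluster k c -> size c + radius k c <= k.
Proof.
elim: c => [//|i p IHp] cp; have [/IHp sp rp ik _] := is_cluster_cons cp.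
by rewrite /=; lia.
Qed.

Fixpoint label_seqs (n : nat) : seq (seq nat) :=
  if n is n'.+1 then
    [::] :: [seq i :: c | i <- iota 0 k.+1, c <- label_seqs n']
  else [:: [::]].

Lemma size_label_seqs n : size (label_seqs n) <= k.+2 ^ n.
Proof.
elim: n => // n IHn.
have -> : size (label_seqs n.+1) = (k.+1 * size (label_seqs n)).+1.
  by rewrite -[in RHS](size_iota 0 k.+1) -(size_allpairs cons).
rewrite expnS.
have : 0 < k.+2 ^ n by rewrite expn_gt0.
by move: IHn; nia.
Qed.

Lemma mem_label_seqs n c : is_cluster k c -> size c <= n -> c \in label_seqs n.
Proof.
elim: n c => [|n IHn] [|i p] // cp sp; rewrite in_cons; apply/orP; right.
have [/IHn IHp rp ik _] := is_cluster_cons cp.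
by apply: allpairs_f; [rewrite mem_iota|exact: IHp].
Qed.

(* The vertices of a cluster [c] are numbered from 0; an edge joins two blocks of
   consecutive vertices with the same rank completely. *)
Definition base_vertex (v : seq nat * nat) : bool :=
  is_cluster k v.1 && (v.2 < delta ^ (k.*2.+1 - size v.1)).

Definition base_list : seq (seq nat * nat) :=
  [seq v <- [seq (c, x) | c <- label_seqs k, x <- iota 0 (delta ^ k.*2.+1)]
     | base_vertex v].

Lemma mem_base_list v : (v \in base_list) = base_vertex v.
Proof.
rewrite mem_filter; case: (boolP (base_vertex v)) => //=.
case: v => c x /andP[/= cc xd]; apply: allpairs_f.
  by apply: mem_label_seqs => //; have := size_cluster cc; lia.
rewrite mem_iota /= add0n (leq_trans xd) // leq_pexp2l //; lia.
Qed.

Lemma size_base_list : size base_list <= k.+2 ^ k * delta ^ k.*2.+1.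
Proof.
rewrite size_filter (leq_trans (count_size _ _)) // size_allpairs size_iota.
by rewrite leq_mul2r size_label_seqs orbT.
Qed.

Definition base_graph := seq_sub base_list.

Lemma card_base_graph : #|{: base_graph}| <= k.+2 ^ k * delta ^ k.*2.+1.
Proof.
rewrite cardE -(size_map val) (leq_trans _ size_base_list) // uniq_leq_size //.
  by rewrite map_inj_uniq ?enum_uniq //; exact: val_inj.
by move=> _ /mapP[u _ ->]; exact: valP.
Qed.

(** With [i] the last label, blocks of [delta ^ i.+1] parent vertices meet blocks of [delta ^ i]
    child vertices; the size of each block is the degree of the vertices opposite. *)
Definition base_child (u v : seq nat * nat) : bool :=
  [&& 0 < size v.1, behead v.1 == u.1
    & u.2 %/ delta ^ (head 0 v.1).+1 == v.2 %/ delta ^ (head 0 v.1)].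

Definition base_rel : rel base_graph :=
  [rel u v | base_child (val u) (val v) || base_child (val v) (val u)].

Lemma base_rel_sym : symmetric base_rel.
Proof. by move=> u v; rewrite /base_rel /= orbC. Qed.

Lemma base_vertexP (u : base_graph) : base_vertex (val u).
Proof. by rewrite -mem_base_list; exact: valP. Qed.

Lemma base_cluster (u : base_graph) : is_cluster k (val u).1.
Proof. by have /andP[] := base_vertexP u. Qed.

Lemma base_rel_nbr u v : base_rel u v ->
  exists2 i, i < k.+2 & cluster_nbr k (val u).1 i = Some (val v).1.
Proof.
have childP (w w' : base_graph) : base_child (val w) (val w') ->
    exists2 i, (val w').1 = i :: (val w).1
      & cluster_nbr k (val w).1 i = Some (val w').1.
  move=> /and3P[]; have := base_cluster w'; case: (val w').1 => //= i p.
  move=> /andP[_ /eqP nE] _ /eqP <- _; by exists i.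
move=> /orP[] /childP[i wE nE].
  exists i => //; have := base_cluster v.
  rewrite wE => /is_cluster_cons[_ _ ik _].
  by lia.
exists i.+1; last by rewrite wE /cluster_nbr /= eqxx.
by have := base_cluster u; rewrite wE => /is_cluster_cons[_ _ ik _].
Qed.

Lemma card_base_block d P m : is_cluster k d -> 0 < P ->
  m.+1 * P <= delta ^ (k.*2.+1 - size d) ->
  #|[set y : base_graph | ((val y).1 == d) && ((val y).2 %/ P == m)]| = P.
Proof.
move=> cd P0 mP.
have ok (j : 'I_P) : (d, m * P + j) \in base_list.
  rewrite mem_base_list /base_vertex cd /= (leq_trans _ mP) //.
  by rewrite mulSnr ltn_add2l ltn_ord.
pose g j : base_graph := SeqSub (ok j).
have gi : injective g.
  by move=> i j /(congr1 val) /= [/addnI ij]; apply: val_inj.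
rewrite -[RHS]card_ord -(card_imset _ gi); apply: eq_card => y.
rewrite inE; apply/andP/imsetP => [[/eqP yd /eqP ym]|[j _ ->]].
  have yP : (val y).2 %% P < P by rewrite ltn_mod.
  exists (Ordinal yP) => //; apply: val_inj; rewrite /= -ym -divn_eq -yd.
  exact: surjective_pairing.
by rewrite /= eqxx divnMDl // divn_small ?addn0.
Qed.

(** Ensures that the block opposite a vertex is full. The exponent [k.*2.+1] leaves at least [k + 1]
    factors [delta] at depth at most [k], enough for the largest blocks. *)
Lemma block_fits a M s s' : a < delta ^ M -> s <= M ->
  (a %/ delta ^ s).+1 * delta ^ s' <= delta ^ (M - s + s').
Proof.
move=> aM sM; rewrite expnD leq_mul2r; apply/orP; right.
by rewrite ltn_divLR ?expn_gt0 ?delta_gt0 // -expnD subnK.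
Qed.

Lemma card_base_nbrs (u : base_graph) i d :
  cluster_nbr k (val u).1 i = Some d ->
  #|[set y | base_rel u y & (val y).1 == d]| = delta ^ i.
Proof.
have [c [a E]] : exists (c : seq nat) (a : nat), val u = (c, a).
  by exists (val u).1, (val u).2; exact: surjective_pairing.
have := base_vertexP u; rewrite {1}E => /andP[/= cu au]; rewrite E /= => nE.
have sc := size_cluster cu; have := nE; rewrite /cluster_nbr.
case: ifP => [|_].
  case: c E cu au nE sc => // j p E cu au nE sc /eqP /= iE [pd].
  rewrite -{}pd {}iE in nE *; have [cd rp jk _] := is_cluster_cons cu.
  have := @card_base_block p (delta ^ j.+1) (a %/ delta ^ j) cd.
  rewrite expn_gt0 delta_gt0 => <- //; last first.
    have := @block_fits a (k.*2.+1 - (size p).+1) j j.+1 au.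
    rewrite (_ : _ - j + j.+1 = k.*2.+1 - size p).
      by apply; rewrite -addnn; move: sc => /=; lia.
    by rewrite -addnn; move: sc => /=; lia.
  apply: eq_card => y; rewrite !inE /base_rel /base_child /= E /=.
  have [yE|_] := eqVneq (ssval y).1 p; rewrite ?andbF // yE andbT.
  have -> : (behead p == j :: p) = false.
    by apply/eqP => /(congr1 size); rewrite size_behead /=; lia.
  by rewrite andbF.
case: ifP => // /andP[rc ik] [dE].
have cd : is_cluster k d by rewrite -dE /= cu nE dE eqxx.
have := @card_base_block d (delta ^ i) (a %/ delta ^ i.+1) cd.
rewrite expn_gt0 delta_gt0 => <- //; last first.
  have := @block_fits a (k.*2.+1 - size c) i.+1 i au.
  rewrite -dE (_ : _ - i.+1 + i = k.*2.+1 - size (i :: c)).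
    by apply; rewrite -addnn; lia.
  by rewrite -addnn /=; lia.
apply: eq_card => y; rewrite !inE /base_rel /base_child /= E -dE /=.
have [yE|_] := eqVneq (ssval y).1 (i :: c); rewrite ?andbF // yE /= eqxx andbT.
have -> : (behead c == i :: c) = false.
  by apply/eqP => /(congr1 size); rewrite size_behead /=; lia.
by rewrite andbF orbF eq_sym.
Qed.

End BaseGraph.

(** * Cluster graphs of large girth *)

Record cluster_graph (k delta n : nat) := ClusterGraph {
  cvertex :> finType;
  cadj : rel cvertex;
  cluster : cvertex -> seq nat;
  croot : cvertex;
  cadj_sym : symmetric cadj;
  cadj_girth : girth_gt n cadj;
  cadj_connected : forall x y, connect cadj x y;
  cluster_root : cluster croot = [::];
  clusterP : forall x, is_cluster k (cluster x);
  cadj_nbr : forall x y, cadj x y ->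
    exists2 i, i < k.+2 & cluster_nbr k (cluster x) i = Some (cluster y);
  card_cadj : forall x i a, cluster_nbr k (cluster x) i = Some a ->
    #|[set y | cadj x y & cluster y == a]| = delta ^ i
}.

Lemma nonbacktracking_map (V W : eqType) (f : V -> W) s : injective f ->
  nonbacktracking (map f s) = nonbacktracking s.
Proof.
move=> fi; elim: s => [//|x [|y [|z s]] IHs] //.
rewrite -[LHS]/((f x != f z) && nonbacktracking (map f [:: y, z & s])).
by rewrite IHs (inj_eq fi).
Qed.

Lemma girth_gt_preim (V W : eqType) (f : V -> W) n (e : rel W) :
  injective f -> girth_gt n e -> girth_gt n (relpre f e).
Proof.
move=> fi girth x p xp np sp; rewrite -(inj_eq fi) -last_map.
apply: girth; [by rewrite path_map| |by rewrite size_map].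
by rewrite -map_cons nonbacktracking_map.
Qed.

Section Component.
Context (V : finType) (e : rel V) (r : V).
Hypothesis e_sym : symmetric e.

(** The lift may be disconnected, whereas a network is connected; a component keeps the girth and
    the degrees. *)
Definition component := {x : V | connect e r x}.

Definition component_rel : rel component := relpre val e.

Lemma component_connected (x y : component) : connect component_rel x y.
Proof.
pose root : component := Sub r (connect0 e r).
have to_root (z : component) : connect component_rel root z.
  case: z => z rz; have /connectP[p rp zE] := rz.
  elim/last_ind: p z rz rp zE => [|p z' IHp] z rz rp zE.
    by rewrite (_ : exist _ z rz = root) //; apply: val_inj.
  move: rp zE; rewrite rcons_path last_rcons => /andP[rp pz'] zE.
  have rp' : connect e r (last r p) by apply/connectP; exists p.
  apply: connect_trans (IHp _ rp' rp erefl) (connect1 _).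
  by rewrite /component_rel /= zE.
have sym : symmetric component_rel by move=> u v; exact: e_sym.
apply: connect_trans (to_root y).
by rewrite (sym_connect_sym sym) to_root.
Qed.

Lemma card_component (x : component) (P : pred V) :
  #|[set y : component | component_rel x y & P (val y)]| =
  #|[set y | e (val x) y & P y]|.
Proof.
rewrite -(card_imset _ val_inj); congr #|pred_of_set _|; apply/finset.setP => y.
apply/imsetP/idP => [[z]|]; rewrite !inE; first by move=> zP ->.
move=> /andP[xy Py].
have ry : connect e r y := connect_trans (valP x) (connect1 xy).
by exists (Sub y ry) => //; rewrite inE /component_rel /= xy.
Qed.
End Component.

(** A field with [2 ^ Q] elements is large enough for an injection [iota] of the base vertices. The
    lift multiplies their number by [#|F| ^ (4 * n)]. *)
Lemma cluster_graph_exists k delta n Q : 0 < delta -> 0 < Q ->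
  k.+2 ^ k * delta ^ k.*2.+1 <= 2 ^ Q ->
  exists G : cluster_graph k delta n, #|G| <= 2 ^ (Q * (4 * n).+1).
Proof.
move=> d0 Q0 HQ.
have [F F2 cF] := PrimePowerField (isT : prime 2) Q0.
pose H : finType := base_graph k delta.
have cH : #|H| <= #|F|.
  by rewrite cF (leq_trans _ HQ) //; exact: card_base_graph.
pose iota (x : H) : F := enum_val (widen_ord cH (enum_rank x)).
have iota_inj : injective iota.
  by move=> x y /enum_val_inj /(congr1 val) /= /val_inj /enum_rank_inj.
have Hsym := @base_rel_sym k delta.
pose e := lift_rel (@base_rel k delta) iota (N := n).
have e_sym : symmetric e by exact: lift_rel_sym.
have r0 : base_vertex k delta ([::], 0) by rewrite /base_vertex /= expn_gt0 d0.
rewrite -mem_base_list // in r0.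
pose r : H * lift_group F n := (SeqSub r0, [ffun=> 0%R]).
have G_nbr (x y : component e r) : component_rel x y ->
    exists2 i, i < k.+2 &
      cluster_nbr k (val (val x).1).1 i = Some (val (val y).1).1.
  by move=> /andP[/(base_rel_nbr d0)].
have G_card (x : component e r) i a :
    cluster_nbr k (val (val x).1).1 i = Some a ->
    #|[set y : component e r | component_rel x y & (val (val y).1).1 == a]| =
      delta ^ i.
  move=> xa; rewrite (card_component x (fun v => (val v.1).1 == a)).
  rewrite (card_lift_nbrs _ _ _ (fun v => (val v).1 == a)).
  exact: card_base_nbrs.
exists (@ClusterGraph k delta n (component e r) (@component_rel _ e r)
  (fun x => (val (val x).1).1) (Sub r (connect0 e r))
  (fun x y => e_sym (val x) (val y))
  (girth_gt_preim val_inj (lift_girth F2 iota_inj (N := n)))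
  (component_connected e_sym) erefl (fun x => base_cluster d0 _) G_nbr G_card).
rewrite /= card_sig (leq_trans (max_card _)) // card_prod card_lift_group cF.
by rewrite -expnM mulnS expnD leq_mul // -cF.
Qed.

Section ClusterGraphTheory.
Context (k delta n : nat) (G : cluster_graph k delta n).

Lemma cluster_nbr_inj c i j a :
  cluster_nbr k c i = Some a -> cluster_nbr k c j = Some a -> i = j.
Proof.
rewrite /cluster_nbr; case: ifP => [/andP[c0 /eqP->] [<-]|_].
  case: ifP => [/andP[_ /eqP->]//|_]; case: ifP => // _ [/(congr1 size)].
  by rewrite /= size_behead; lia.
case: ifP => // _ [<-]; case: ifP => [/andP[_ _] [/(congr1 size)]|_].
  by rewrite /= size_behead; lia.
by case: ifP => // _ [->].
Qed.

Lemma cadj_irr : irreflexive (@cadj k delta n G).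
Proof.
move=> x; apply/negP => /cadj_nbr[i _]; rewrite /cluster_nbr.
case: ifP => [/andP[c0 _] [/(congr1 size)]|_].
  by rewrite size_behead; lia.
by case: ifP => // _ [/(congr1 size)] /=; lia.
Qed.

(** Each neighbour belongs to exactly one label. The count thus depends on the neighbouring clusters
    only, which makes bisimilarity a colour refinement. *)
Lemma card_cadj_sum (x : G) (P : pred (seq nat)) :
  #|[set u | cadj x u & P (cluster u)]| =
  \sum_(i < k.+2) if cluster_nbr k (cluster x) i is Some a
                  then if P a then delta ^ i else 0 else 0.
Proof.
transitivity (\sum_(u | cadj x u && P (cluster u)) \sum_(i < k.+2)
    (cluster_nbr k (cluster x) i == Some (cluster u) : nat)).
  rewrite -sum1_card; under eq_bigl do rewrite inE.
  apply: eq_bigr => u /andP[/cadj_nbr[i ik iu] _].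
  rewrite (bigD1 (Ordinal ik)) //= iu eqxx big1 // => j ji.
  apply/eqP; rewrite eqb0; apply: contra ji => /eqP ju.
  by apply/eqP/val_inj; exact: cluster_nbr_inj ju iu.
rewrite exchange_big; apply: eq_bigr => i _ /=.
case E: (cluster_nbr k (cluster x) i) => [a|]; last by rewrite big1.
case: ifPn => [Pa|nPa].
  rewrite -(card_cadj E) -sum1_card; under [RHS]eq_bigl do rewrite inE.
  rewrite -big_mkcondr /=; apply: eq_bigl => u.
  rewrite -andbA; congr (_ && _); rewrite (inj_eq Some_inj) eq_sym.
  by case: eqP => [->|]; rewrite ?Pa ?andbF.
rewrite big1 // => u /andP[_ Pu]; apply/eqP; rewrite eqb0 (inj_eq Some_inj).
by apply: contraNneq nPa => ->.
Qed.

(** Colours are bisimilarity classes of clusters. The root has radius [k] and its child through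
    label 0 has radius [k - 1], so they share their colour at level [k - 1]. *)
Lemma cluster_view_isomorphism (x y : G) : 0 < k -> k.*2 <= n.+2 ->
  cluster x = [::] -> cluster y = [:: 0] ->
  exists pi : {perm G}, pi x = y /\
    forall p, path (@cadj _ _ _ G) x p -> size p < k.-1 ->
      nbrs (@cadj _ _ _ G) (pi (last x p)) =
        pi @: nbrs (@cadj _ _ _ G) (last x p).
Proof.
move=> k0 kn cx cy.
pose color t (u v : G) := bisim k t (cluster u) (cluster v).
apply: (@view_isomorphism G _ color k.-1 n) => //.
- exact: cadj_sym.
- exact: cadj_girth.
- by move: kn; rewrite -!addnn; lia.
- move=> t; apply/equivalence_relP; split=> [u|u v uv w]; rewrite /color.
    exact: bisim_refl.
  apply/idP/idP; apply: bisim_trans => //; exact: bisim_sym.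
- by move=> t u v; exact: bisimS.
- move=> t u v /forallP uv z; rewrite !card_cadj_sum.
  apply: eq_bigr => i _; move: (uv i).
  case: (cluster_nbr k (cluster u) i) => [a|];
    case: (cluster_nbr k (cluster v) i) => [b|] // ab.
  congr (if _ then _ else _); apply/idP/idP => za; first exact: bisim_trans ab.
  by apply: bisim_trans za _; exact: bisim_sym.
- apply: bisim_radius; [exact: clusterP|exact: clusterP| |].
    by rewrite cx /= leq_pred.
  by rewrite cy /= subn0; lia.
Qed.

Lemma card_nbrs_le (x : G) : 0 < delta ->
  #|nbrs (@cadj _ _ _ G) x| <= k.+2 * delta ^ k.+1.
Proof.
move=> delta_gt0; rewrite /nbrs; have := card_cadj_sum x predT.
under eq_finset do rewrite andbT; move=> ->.
rewrite -[X in X * _](card_ord k.+2) -sum_nat_const leq_sum // => i _.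
case: cluster_nbr => //= _; rewrite leq_pexp2l // -ltnS; exact: ltn_ord.
Qed.

Lemma card_nbrs_root : 0 < k -> delta ^ k <= #|nbrs (@cadj _ _ _ G) (croot G)|.
Proof.
move=> k0; have kE : cluster_nbr k (cluster (croot G)) k = Some [:: k].
  by rewrite cluster_root /cluster_nbr /= k0 leqnn.
rewrite -(card_cadj kE); apply: subset_leq_card; apply/fintype.subsetP => y.
by rewrite !inE => /andP[].
Qed.

Definition root_cluster : {set G} := [set x | cluster x == [::]].

Lemma root_independent (x y : G) : x \in root_cluster -> y \in root_cluster ->
  ~~ cadj x y.
Proof.
rewrite !inE => /eqP cx /eqP cy; apply/negP => /cadj_nbr[i _].
by rewrite cx cy /cluster_nbr /=; case: ifP.
Qed.

Lemma card_cadj_root (x : G) i : 0 < k -> i <= k -> x \in root_cluster ->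
  #|[set y | cadj x y & cluster y == [:: i]]| = delta ^ i.
Proof.
rewrite inE => k0 ik /eqP cx; apply: card_cadj.
by rewrite cx /cluster_nbr /= k0 ik.
Qed.

Lemma card_cadj_child (y : G) i p : cluster y = i :: p ->
  #|[set x | cadj y x & cluster x == p]| = delta ^ i.+1.
Proof. by move=> cy; apply: card_cadj; rewrite cy /cluster_nbr /= eqxx. Qed.

(** Edges to parents are counted twice for each last label [i]: the child has [delta ^ i.+1] of
    them, the parent at most [delta ^ i]. This leaves at most [#|G| / delta] vertices for each of
    [k + 1] labels. *)
Lemma card_nonroot : 0 < delta ->
  #|~: root_cluster| * delta <= k.+1 * #|G|.
Proof.
move=> delta_gt0.
pose B i := [set y : G | (0 < size (cluster y)) && (head 0 (cluster y) == i)].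
have cB i : #|B i| * delta <= #|G|.
  have di0 : 0 < delta ^ i by rewrite expn_gt0 delta_gt0.
  rewrite -(leq_pmul2r di0) -mulnA -expnS.
  rewrite -[X in X <= _]sum_nat_const -[X in _ <= X]sum_nat_const.
  pose E (x y : G) : bool := cadj x y && (cluster y == i :: cluster x).
  apply: (@leq_trans (\sum_(y in B i) \sum_x E x y)).
    apply: leq_sum => y; rewrite inE => /andP[].
    case cy : (cluster y) => [//|j p] _ /= /eqP ji; rewrite {}ji in cy.
    rewrite -(card_cadj_child cy) -sum1_card big_mkcond /= leq_sum // => x _.
    by rewrite inE /E cy eqseq_cons eqxx /= cadj_sym eq_sym; case: ifP => // ->.
  rewrite exchange_big /= leq_sum // => x _.
  apply: (@leq_trans #|[set y | E x y]|).
    rewrite -sum1_card big_mkcond [X in _ <= X]big_mkcond leq_sum // => y _.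
    by rewrite inE; case: ifP; case: (E x y).
  have [->|[y]] := set_0Vmem [set y | E x y]; first by rewrite cards0.
  rewrite inE => /andP[_ /eqP cy].
  have xi : cluster_nbr k (cluster x) i = Some (i :: cluster x).
    by have := clusterP y; rewrite cy => /andP[_ /eqP].
  rewrite -(card_cadj xi); apply: subset_leq_card.
  by apply/fintype.subsetP => z; rewrite !inE.
apply: (@leq_trans ((\sum_(i < k.+1) #|B i|) * delta)); last first.
  by rewrite big_distrl -[X in X * _](card_ord k.+1) -sum_nat_const leq_sum.
rewrite leq_mul2r; apply/orP; right; rewrite -sum1_card.
apply: (@leq_trans (\sum_(y in ~: root_cluster) \sum_(i < k.+1) (y \in B i))).
  apply: leq_sum => y; rewrite !inE; case cy: (cluster y) => [//|i p] _.
  have := clusterP y; rewrite cy => /is_cluster_cons[_ _ ik _].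
  by rewrite (bigD1 (Ordinal (ik : i < k.+1))) //= inE cy /= eqxx.
rewrite exchange_big leq_sum // => i _.
rewrite -sum1_card big_mkcond [X in _ <= X]big_mkcond leq_sum // => y _.
by case: ifP; case: (y \in B i).
Qed.

End ClusterGraphTheory.

(** * Networks and relabellings *)

Local Open Scope ring_scope.
Local Open Scope set_scope.

Lemma set2_eq (V : finType) (u v x y : V) : [set u; v] = [set x; y] ->
  (u = x /\ v = y) \/ (u = y /\ v = x).
Proof.
move=> E; have : u \in [set x; y] by rewrite -E set21.
have : v \in [set x; y] by rewrite -E set22.
have : x \in [set u; v] by rewrite E set21.
have : y \in [set u; v] by rewrite E set22.
rewrite !inE => /orP[]/eqP-> /orP[]/eqP-> /orP[]/eqP ? /orP[]/eqP ?;
  by subst; auto.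
Qed.

Section SimpleNetwork.
Context (R : realType) (V : finType) (a : rel V) (wt : V -> V -> R).
Hypotheses (a_sym : symmetric a) (a_irr : irreflexive a).
Hypothesis a_connected : forall u v, connect a u v.
Hypothesis wt_sym : forall u v, wt u v = wt v u.
Hypothesis wt_ge0 : forall u v, 0 <= wt u v.

Definition rel_edges : {set {set V}} :=
  [set [set u.1; u.2] | u in [set u : V * V | a u.1 u.2]].

Definition rel_weight (s : {set V}) : R :=
  if [pick u : V * V | s == [set u.1; u.2]] is Some u then wt u.1 u.2 else 0.

Lemma mem_rel_edges u v : ([set u; v] \in rel_edges) = a u v.
Proof.
apply/imsetP/idP => [[[x y]]|uv]; last by exists (u, v); rewrite ?inE.
by rewrite inE /= => xy /set2_eq[[-> ->]|[-> ->]] //; rewrite a_sym.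
Qed.

Lemma rel_edgesP s :
  reflect (exists u v, s = [set u; v] /\ a u v) (s \in rel_edges).
Proof.
apply: (iffP imsetP) => [[[u v]]|[u [v [-> uv]]]].
  by rewrite inE => uv ->; exists u, v.
by exists (u, v); rewrite ?inE.
Qed.

Lemma rel_weightE u v : rel_weight [set u; v] = wt u v.
Proof.
rewrite /rel_weight; case: pickP => [[x y] /= /eqP/set2_eq|/(_ (u, v))].
  by case=> -[-> ->] //; exact: wt_sym.
by rewrite /= eqxx.
Qed.

Fact rel_edges_card2 s : s \in rel_edges -> #|s| = 2.
Proof.
move=> /rel_edgesP[u [v [-> uv]]]; rewrite cards2.
by case: eqP uv => // ->; rewrite a_irr.
Qed.

Lemma rel_weight_ge0 s : 0 <= rel_weight s.
Proof. by rewrite /rel_weight; case: pickP. Qed.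

Fact rel_network_connected u v :
  connect [rel x y | [set x; y] \in rel_edges] u v.
Proof.
by rewrite (eq_connect (e' := a)) // => x y; rewrite /= mem_rel_edges.
Qed.

Definition rel_ident (s : {perm V}) (v : V) : nat := enum_rank (s v).

Fact rel_ident_inj s : injective (rel_ident s).
Proof. by move=> u v /val_inj/enum_rank_inj/perm_inj. Qed.

Definition simple_network (s : {perm V}) : network R :=
  @Network R V rel_edges rel_weight (rel_ident s) rel_edges_card2
    (fun e _ => rel_weight_ge0 e) (@rel_ident_inj s) rel_network_connected.

Lemma adjE s : @adj R (simple_network s) =2 a.
Proof. by move=> u v; rewrite /adj /= mem_rel_edges. Qed.

Section Simulation.
Context (A : algorithm R) (w : sample A) (s s' tau : {perm V}).
Hypothesis s'E : forall v, s' (tau v) = s v.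

Definition locally_iso (u : V) :=
  forall z, a (tau u) (tau z) = a u z /\ wt (tau u) (tau z) = wt u z.

Lemma neighborE v i : locally_iso v ->
  neighbor (G := simple_network s') (tau v) i =
  omap tau (neighbor (G := simple_network s) v i).
Proof.
move=> vP; rewrite /neighbor.
case: pickP => [u /andP[]|/= no]; case: pickP => [z /andP[]|/= no'] //=.
- rewrite !adjE => vz /eqP zi vu /eqP ui; congr Some.
  apply: (@rel_ident_inj s'); rewrite ui -zi /rel_ident /= s'E //.
- rewrite !adjE => vu /eqP ui; have := no' (tau^-1 u)%g.
  rewrite adjE -(vP _).1 permKV vu /= /rel_ident -s'E permKV.
  by move: ui; rewrite /= /rel_ident => ->; rewrite eqxx.
- rewrite adjE => vz zi; have := no (tau z); rewrite adjE (vP z).1 vz /=.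
  by move: zi; rewrite /= /rel_ident s'E => ->.
Qed.

(** The networks differ in their identifiers only, so size, maximum degree and coins agree. Each
    round consults the states one step further out. *)
Lemma run_locally_iso t v :
  (forall p, path a v p -> (size p <= t)%N -> locally_iso (last v p)) ->
  run (G := simple_network s') w t (tau v) =
  run (G := simple_network s) w t v.
Proof.
have identE u : rel_ident s' (tau u) = rel_ident s u by rewrite /rel_ident s'E.
elim: t v => [|t IHt] v vP.
  have v0 : locally_iso v by exact: (vP [::]).
  rewrite /= /init_state /= identE; congr (init _ _ _ _).
  apply/funext => i; rewrite /incident_weights neighborE //.
  case: (neighbor _ _) => //= u.
  by rewrite !rel_weightE (v0 u).2.
have v0 : locally_iso v by exact: (vP [::]).
rewrite [LHS]/= [RHS]/= IHt; last first.
  by move=> p vp sp; apply: vP => //; exact: leqW.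
congr (recv _ _); apply/funext => i; rewrite /inbox neighborE //.
case E : (neighbor _ _) => [u|] //=.
have vu : a v u.
  move: E; rewrite /neighbor; case: pickP => //= z /andP[].
  by rewrite adjE => vz _ [<-].
congr Some; rewrite identE IHt // => p up sp.
by apply: (vP (u :: p)) => //=; rewrite vu.
Qed.

End Simulation.
End SimpleNetwork.

(** * From vertex covers to 2-spanners *)

Section CoverGadget.
Context (R : realType) (T : finType) (e : rel T) (W : R).
Hypotheses (e_sym : symmetric e) (e_irr : irreflexive e).
Hypothesis e_connected : forall x y, connect e x y.
Hypothesis W_ge0 : 0 <= W.

(* The edge between [(x, Some false)] and [(x, Some true)] encodes that [x] is
   in the vertex cover; [(x, None)] provides a detour around it. *)
Definition gadget_vertex : finType := (T * option bool)%type.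

Definition gadget_rel : rel gadget_vertex := [rel u v |
  ((u.1 == v.1) && (u.2 != v.2)) || [&& e u.1 v.1, isSome u.2 & isSome v.2]].

(** Only cover edges, of weight 1, and crossing edges between opposite copies of adjacent vertices,
    of weight [W], can cost anything. *)
Definition gadget_weight (u v : gadget_vertex) : R :=
  if u.1 == v.1 then (isSome u.2 && isSome v.2)%:R
  else if u.2 == v.2 then 0 else W.

Lemma gadget_rel_sym : symmetric gadget_rel.
Proof.
move=> u v; rewrite /gadget_rel /= eq_sym (eq_sym u.2) e_sym.
by rewrite (andbC (isSome u.2)).
Qed.

Lemma gadget_rel_irr : irreflexive gadget_rel.
Proof. by move=> u; rewrite /gadget_rel /= !eqxx e_irr. Qed.

Lemma gadget_connected u v : connect gadget_rel u v.
Proof.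
have same x a b : connect gadget_rel (x, a) (x, b).
  have [->|ab] := eqVneq a b; first exact: connect0.
  by apply: connect1; rewrite /gadget_rel /= eqxx ab.
have lift x y : connect e x y ->
    connect gadget_rel (x, Some true) (y, Some true).
  move=> /connectP[p xp ->]; elim: p x xp => [|z p IHp] x /=.
    by move=> _; exact: connect0.
  move=> /andP[xz zp]; apply: connect_trans (IHp _ zp); apply: connect1.
  by rewrite /gadget_rel /= xz orbT.
case: u v => [x a] [y b]; apply: connect_trans (same x a (Some true)) _.
by apply: connect_trans (lift _ _ (e_connected x y)) (same _ _ _).
Qed.

Lemma gadget_weight_sym u v : gadget_weight u v = gadget_weight v u.
Proof.
by rewrite /gadget_weight eq_sym (eq_sym u.2) (andbC (isSome u.2)).
Qed.

Lemma gadget_weight_ge0 u v : 0 <= gadget_weight u v.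
Proof. by rewrite /gadget_weight; case: ifP => _ //; case: ifP. Qed.

Definition gadget_network (s : {perm gadget_vertex}) : network R :=
  simple_network gadget_rel_sym gadget_rel_irr gadget_connected
    gadget_weight_ge0 s.

Lemma gadget_path u p : path gadget_rel u p ->
  exists q, [/\ path e u.1 q, (size q <= size p)%N & last u.1 q = (last u p).1].
Proof.
elim: p u => [|v p IHp] u /=; first by exists [::].
move=> /andP[uv /IHp[q [vq sq lq]]].
move: uv => /orP[/andP[/eqP uv _]|/and3P[uv _ _]].
  by exists q; rewrite uv; split=> //; exact: leqW.
by exists (v.1 :: q); rewrite /= uv.
Qed.

Lemma gadget_perm_inj (pi : {perm T}) :
  injective (fun u : gadget_vertex => (pi u.1, u.2) : gadget_vertex).
Proof. by move=> [x a] [y b] [/perm_inj-> ->]. Qed.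

Definition gadget_perm (pi : {perm T}) : {perm gadget_vertex} :=
  perm (@gadget_perm_inj pi).

Lemma gadget_locally_iso (pi : {perm T}) u :
  nbrs e (pi u.1) = pi @: nbrs e u.1 ->
  locally_iso gadget_rel gadget_weight (gadget_perm pi) u.
Proof.
move=> Npi z; have eE : e (pi u.1) (pi z.1) = e u.1 z.1.
  have := mem_imset (nbrs e u.1) z.1 (@perm_inj _ pi).
  by rewrite -Npi !inE.
by rewrite /gadget_rel /gadget_weight !permE /= eE (inj_eq perm_inj).
Qed.

Definition cover_edge (x : T) : {set gadget_vertex} :=
  [set (x, Some false); (x, Some true)].

Lemma cover_edge_inj : injective cover_edge.
Proof. by move=> x y /set2_eq[[[]]|[]]. Qed.

Definition selected (A : algorithm R) (w : sample A) (t : nat)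
    (s : {perm gadget_vertex}) (x : T) : bool :=
  cover_edge x \in output_edges (run (G := gadget_network s) w t).

Lemma mem_output_edges (A : algorithm R) s
    (st : vertex (gadget_network s) -> state A) u v : gadget_rel u v ->
  ([set u; v] \in output_edges st) =
  odflt (fun=> false) (output (st u)) (rel_ident s v) ||
  odflt (fun=> false) (output (st v)) (rel_ident s u).
Proof.
move=> uv; have vu : gadget_rel v u by rewrite gadget_rel_sym.
apply/imset2P/orP.
  move=> [x y _]; rewrite inE => /andP[_ /andP[xy so]] /set2_eq.
  by case=> -[? ?]; subst; [left|right].
case=> so; [exists u v|exists v u] => //.
- by rewrite inE; apply/andP; split=> //; rewrite /selects adjE; apply/andP.
- by rewrite inE; apply/andP; split=> //; rewrite /selects adjE; apply/andP.
by rewrite finset.setUC.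
Qed.

Lemma selected_locally_iso (A : algorithm R) (w : sample A) t
    (s s' : {perm gadget_vertex}) (pi : {perm T}) x :
  (forall u, s' (gadget_perm pi u) = s u) ->
  (forall p, path e x p -> (size p <= t)%N ->
     nbrs e (pi (last x p)) = pi @: nbrs e (last x p)) ->
  selected w t s' (pi x) = selected w t s x.
Proof.
move=> s'E xP; have xx z : gadget_rel (z, Some false) (z, Some true).
  by rewrite /gadget_rel /= eqxx.
rewrite /selected /cover_edge !mem_output_edges //.
have permxE b : gadget_perm pi (x, b) = (pi x, b) by rewrite permE.
have runE b : run (G := gadget_network s') w t (pi x, b) =
              run (G := gadget_network s) w t (x, b).
  rewrite -permxE; apply: run_locally_iso => //; first exact: gadget_weight_sym.
  move=> p up sp.
  apply: gadget_locally_iso; have [q [xq sq <-]] := gadget_path up.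
  by apply: xP => //; exact: leq_trans sp.
by rewrite !runE /rel_ident -!permxE !s'E.
Qed.

(** An edge of weight [W] is too expensive. The crossing edge from [(x, Some false)] to
    [(y, Some true)] is then spanned through [(x, Some true)] or [(y, Some false)], hence by a cover
    edge. *)
Lemma good_outcome_cover (A : algorithm R) s
    (st : vertex (gadget_network s) -> state A) alpha x y :
  good_outcome alpha st -> alpha * opt_2spanner (gadget_network s) < W ->
  e x y ->
  (cover_edge x \in output_edges st) || (cover_edge y \in output_edges st).
Proof.
move=> [_ [HE spn] cost] optW xy; set H := output_edges st in HE spn cost *.
have light f : f \in H -> weight (n := gadget_network s) f != W.
  move=> fH; apply/eqP => fW; have := le_lt_trans cost optW.
  rewrite /total_weight (bigD1 f) // fW ltNge => /negP[].
  by rewrite lerDl sumr_ge0 // => f' _; exact/rel_weight_ge0/gadget_weight_ge0.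
have Hrel u v : [set u; v] \in H -> gadget_rel u v.
  move=> /(fintype.subsetP HE).
  by rewrite mem_rel_edges //; exact: gadget_rel_sym.
have Hwt u v : [set u; v] \in H -> gadget_weight u v != W.
  by move=> /light; rewrite /= rel_weightE //; exact: gadget_weight_sym.
have xNy : (x == y) = false by apply/eqP => xE; rewrite xE e_irr in xy.
have [|p [up lp sp]] := spn (x, Some false) (y, Some true).
  by rewrite adjE /gadget_rel /= xy orbT.
case: p up lp sp => [|[z c] [|v [|//]]] /=.
- by move=> _ [xE]; rewrite xE eqxx in xNy.
- move=> /andP[zH _] zE _; have := Hwt _ _ zH.
  by rewrite zE /gadget_weight /= xNy eqxx.
move=> /and3P[xz zv _] vE _; rewrite {}vE in zv.
have := Hrel _ _ xz; have := Hrel _ _ zv.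
have := Hwt _ _ xz; have := Hwt _ _ zv.
rewrite /gadget_rel /gadget_weight /=.
have [xE|xz'] := eqVneq x z.
  rewrite -xE xNy e_irr; case: c xz zv => [[]|] //= xz _ _ _; rewrite ?andbF //.
  by move=> _ _; rewrite /cover_edge {2}xE xz.
case: c xz zv => [[]|] //=; rewrite ?eqxx ?andbF //.
move=> xz; have [->|zy] := eqVneq z y => zv; first by rewrite zv orbT.
by rewrite eqxx.
Qed.

Lemma card_selected_le_weight (A : algorithm R) s
    (st : vertex (gadget_network s) -> state A) (S : {set T}) :
  #|[set x in S | cover_edge x \in output_edges st]|%:R <=
  total_weight (output_edges st) :> R.
Proof.
set B := [set x in S | _].
have wE x : weight (n := gadget_network s) (cover_edge x) = 1.
  rewrite /= rel_weightE ?/gadget_weight /= ?eqxx //.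
  exact: gadget_weight_sym.
have -> : #|B|%:R =
    \sum_(f in cover_edge @: B) weight (n := gadget_network s) f.
  rewrite big_imset /=; last by move=> x y _ _; exact: cover_edge_inj.
  by rewrite (eq_bigr (fun=> 1)) ?sumr_const // => x _; exact: wE.
rewrite /total_weight big_mkcond [leRHS]big_mkcond ler_sum // => f _.
case: ifP => [/imsetP[x]|_]; first by rewrite inE => /andP[_ xo] ->; rewrite xo.
by case: ifP => // _; exact/rel_weight_ge0/gadget_weight_ge0.
Qed.

(** The spanner consists of all free edges and the cover edges outside [S]. Cover edges in [S] are
    bypassed through [(x, None)]; a crossing edge is spanned at an endpoint outside [S]. *)
Lemma opt_2spanner_le s (S : {set T}) :
  {in S &, forall x y, ~~ e x y} ->
  opt_2spanner (gadget_network s) <= #|~: S|%:R.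
Proof.
move=> Sind.
pose H := [set f in rel_edges gadget_rel |
  (rel_weight gadget_weight f == 0) || (f \in cover_edge @: ~: S)].
have weightE := rel_weightE gadget_weight_sym.
have HP u v : gadget_rel u v -> gadget_weight u v = 0 -> [set u; v] \in H.
  move=> uv w0; rewrite inE mem_rel_edges ?weightE ?uv ?w0 ?eqxx //.
  exact: gadget_rel_sym.
have HS x b : x \notin S -> [set (x, Some b); (x, Some (~~ b))] \in H.
  move=> xS; rewrite inE mem_rel_edges; last exact: gadget_rel_sym.
  rewrite /gadget_rel /= eqxx /=; apply/andP; split; first by case: b.
  apply/orP; right; case: b; rewrite /= ?(finset.setUC [set (x, Some true)]);
  by apply: imset_f; rewrite inE.
pose joined (u v : gadget_vertex) := exists p : seq gadget_vertex,
  [/\ path [rel x y | [set x; y] \in H] u p, last u p = v & (size p <= 2)%N].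
have edge1 u v : [set u; v] \in H -> joined u v.
  by move=> uv; exists [:: v]; rewrite /= uv.
have edge2 u z v : [set u; z] \in H -> [set z; v] \in H -> joined u v.
  by move=> uz zv; exists [:: z; v]; rewrite /= uz zv.
have spn : is_2spanner (G := gadget_network s) H.
  split; first by apply/fintype.subsetP => f; rewrite inE => /andP[].
  move=> u v; rewrite adjE => uv; have := uv.
  rewrite /gadget_rel /= => /orP[/andP[/eqP]|].
    case: u v uv => [x a] [y b] uv /= xE; rewrite -xE in uv *.
    case: a b uv => [a|] [b|] uv //= ab; try
      by apply: edge1; apply: HP => //; rewrite /gadget_weight /= eqxx ?andbF.
    by apply: (edge2 _ (x, None)); apply: HP;
      rewrite /gadget_rel /gadget_weight /= ?eqxx.
  case: u v uv => [x [a|]] [y [b|]] //= uv; rewrite ?andbF // !andbT => xy.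
  have xNy : (x == y) = false by apply/eqP => xE; rewrite xE e_irr in xy.
  have [abE|ab] := eqVneq a b.
    by apply: edge1; apply: HP => //; rewrite /gadget_weight /= xNy abE eqxx.
  have bE : b = ~~ a by case: (a) (b) ab => [] [].
  have [xS|xS] := boolP (x \in S).
    have yS : y \notin S by apply: contraL xy => yS; exact: Sind.
    apply: (edge2 _ (y, Some a)); last by rewrite bE; exact: HS.
    by apply: HP; rewrite /gadget_rel /gadget_weight /= ?xNy ?eqxx ?xy ?orbT.
  apply: (edge2 _ (x, Some b)); first by rewrite bE; exact: HS.
  by apply: HP; rewrite /gadget_rel /gadget_weight /= ?xNy ?eqxx ?xy ?orbT.
apply: (@le_trans _ _ (total_weight (G := gadget_network s) H)).
  by rewrite /opt_2spanner; apply: bigmin_le_cond; apply/asboolP.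
rewrite /total_weight /=.
apply: (@le_trans _ _
  (\sum_(f in cover_edge @: ~: S) rel_weight gadget_weight f)).
  rewrite big_mkcond [leRHS]big_mkcond ler_sum // => f _.
  case: ifP => [|_]; last first.
    by case: ifP => // _; exact/rel_weight_ge0/gadget_weight_ge0.
  by rewrite inE => /andP[_ /orP[/eqP->|->//]]; case: ifP.
rewrite big_imset /=; last by move=> x y _ _; exact: cover_edge_inj.
rewrite (eq_bigr (fun=> 1)) ?sumr_const // => x _.
by rewrite weightE /gadget_weight /= eqxx.
Qed.

Lemma num_vertices_gadget s : num_vertices (gadget_network s) = (3 * #|T|)%N.
Proof. by rewrite /num_vertices /= card_prod card_option card_bool mulnC. Qed.

Lemma max_degree_gadget_ge s x :
  (#|nbrs e x| <= max_degree (gadget_network s))%N.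
Proof.
apply: leq_trans (leq_bigmax (x, Some true)).
rewrite -(card_imset _ (f := fun y => (y, Some true) : gadget_vertex));
  last by move=> y z [].
apply: subset_leq_card; apply/fintype.subsetP => _ /imsetP[y xy ->].
by rewrite !inE in xy *; rewrite -/(adj _ _) adjE /gadget_rel /= xy orbT.
Qed.

Lemma max_degree_gadget_le s d : (forall x, #|nbrs e x| <= d)%N ->
  (max_degree (gadget_network s) <= 3 * d.+1)%N.
Proof.
move=> dP; apply/bigmax_leqP => -[x a] _.
apply: (@leq_trans #|finset.setX (x |: nbrs e x) [set: option bool]|).
  apply: subset_leq_card; apply/fintype.subsetP => -[y b].
  rewrite !inE -/(adj _ _) adjE /gadget_rel /= andbT eq_sym.
  by case/orP => [/andP[->]|/andP[->]] //; rewrite orbT.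
rewrite cardsX cardsT card_option card_bool mulnC leq_mul2l /=.
by rewrite (leq_trans (leq_card_setU _ _)) // cards1 add1n ltnS.
Qed.

Lemma max_degree_le_num_vertices s :
  (max_degree (gadget_network s) <= num_vertices (gadget_network s))%N.
Proof. by apply/bigmax_leqP => v _; exact: max_card. Qed.

End CoverGadget.

(** * Averaging over the identifiers *)

(** The expected number of events that hold is at least [2/3] of all, so it cannot be bounded
    everywhere by the smaller fraction [3/5]. *)
Lemma many_events_hold (R : realType) d (Omega : measurableType d)
    (P : probability Omega R) (I : finType) (E : I -> set Omega) :
  (0 < #|I|)%N -> (forall i, measurable (E i)) ->
  (forall i, ((2 / 3)%:E <= P (E i))%E) ->
  exists w, (3 * #|I| < 5 * #|[set i | `[< E i w >]]|)%N.
Proof.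
move=> I0 mE PE; apply: contrapT => /forallNP no.
pose c : R := 3 / 5 * #|I|%:R.
have sumE w : \sum_i (\1_(E i) w : R) = #|[set i | `[< E i w >]]|%:R.
  rewrite -sum1_card natr_sum big_mkcond [RHS]big_mkcond.
  apply: eq_bigr => i _; rewrite indicE inE; case: asboolP => Ew.
    by rewrite mem_set.
  by rewrite memNset.
have le_c w : \sum_i (\1_(E i) w : R) <= c.
  rewrite sumE; have /negP := no w; rewrite -leqNgt -(ler_nat R) !natrM /c.
  by lra.
have : ((\sum_i P (E i)) <= c%:E)%E.
  have -> : (\sum_i P (E i) = \int[P]_w (\sum_i (\1_(E i) w)%:E)%E)%E.
    rewrite ge0_integral_sum //.
    - by apply: eq_bigr => i _; rewrite integral_indic // setIT.
    - by move=> i; by apply/measurable_EFinP; exact: measurable_indic.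
  have -> : c%:E = (\int[P]_w (cst c%:E w))%E.
    rewrite integral_cst //= -[LHS]mule1; congr (_ * _)%E.
    exact/esym/probability_setT.
  apply: ge0_le_integral => //.
  - by move=> w _; apply: sume_ge0 => i _; rewrite lee_fin.
  - apply: (emeasurable_sum _ (h := fun i w => (\1_(E i) w)%:E)) => i.
    by apply/measurable_EFinP; exact: measurable_indic.
  - by move=> w _; rewrite sumEFin lee_fin.
apply/negP; rewrite -ltNge.
apply: (@lt_le_trans _ _ (\sum_(i : I) (2 / 3)%:E)%E); last exact: lee_sum.
rewrite sumEFin lte_fin [ltRHS](_ : _ = 2 / 3 * #|I|%:R) /c.
  have : (0 : R) < #|I|%:R by rewrite ltr0n.
  by move: (#|I|%:R : R) => m m0; lra.
by rewrite sumr_const -[LHS]mulr_natr.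
Qed.

(** * The lower bound on a single cluster graph *)

Section Indistinguishability.
Context (R : realType) (k delta n : nat) (G : cluster_graph k delta n).
Context (A : algorithm R) (alpha : R).

Let e : rel G := @cadj k delta n G.
Let beta : R := Num.max alpha 0.

(** Exceeds [alpha] times the optimum for every assignment of identifiers, so good outcomes avoid
    crossing edges. *)
Definition heavy_weight : R := beta * #|G|%:R + 1.

Lemma beta_ge0 : 0 <= beta.
Proof. by rewrite le_max lexx orbT. Qed.

Fact heavy_weight_ge0 : 0 <= heavy_weight.
Proof. by rewrite addr_ge0 // mulr_ge0 // beta_ge0. Qed.

Definition hard_network (s : {perm gadget_vertex G}) : network R :=
  gadget_network (@cadj_sym k delta n G) (@cadj_irr k delta n G)
    (@cadj_connected k delta n G) heavy_weight_ge0 s.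

Lemma opt_hard_network s :
  alpha * opt_2spanner (hard_network s) <= beta * #|~: root_cluster G|%:R.
Proof.
have opt_ge0 : 0 <= opt_2spanner (hard_network s).
  rewrite /opt_2spanner; apply: le_bigmin => [|H _]; apply: sumr_ge0 => f _;
  exact/rel_weight_ge0/gadget_weight_ge0/heavy_weight_ge0.
apply: (@le_trans _ _ (beta * opt_2spanner (hard_network s))).
  by rewrite ler_wpM2r // le_max lexx.
rewrite ler_wpM2l ?beta_ge0 //; apply: opt_2spanner_le => x y xS yS.
exact: root_independent.
Qed.

Lemma hard_network_lower_bound t : (0 < k)%N -> (k.*2 <= n.+2)%N ->
  (t < k.-1)%N ->
  10 * beta * #|~: root_cluster G|%:R < #|root_cluster G|%:R ->
  exists s, ~ approximates_within A (hard_network s) alpha t.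
Proof.
move=> k_gt0 kn tk; set S := root_cluster G; move=> hS; apply: contrapT => no.
have {no} /choice[E EP] : forall s, exists E : set (sample A),
    [/\ measurable E,
      (E `<=`
        [set w | good_outcome alpha (run (G := hard_network s) w t)])%classic
      & ((2 / 3)%:E <= prob A E)%E].
  by move=> s; apply: contrapT => ns; apply: no; exists s.
have P0 : (0 < #|{perm gadget_vertex G}|)%N by apply/card_gt0P; exists 1%g.
have [s|s|w Hw] := @many_events_hold R _ _ (prob A) _ E P0;
  [by case: (EP s)|by case: (EP s)|].
set good := [set s | _] in Hw.
pose sel := selected (@cadj_sym k delta n G) (@cadj_irr k delta n G)
  (@cadj_connected k delta n G) heavy_weight_ge0 w t.
have goodP s : s \in good -> good_outcome alpha (run (G := hard_network s) w t).
  by rewrite inE => /asboolP Es; case: (EP s) => _ + _; apply.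
have cover s x y : s \in good -> e x y -> sel s x || sel s y.
  move=> /goodP gs xy; apply: (good_outcome_cover gs) xy.
  apply: le_lt_trans (opt_hard_network s) _.
  rewrite ltr_pwDr // ler_wpM2l ?beta_ge0 // ler_nat; exact: max_card.
have cost s : s \in good ->
    #|[set x in S | sel s x]|%:R <= beta * #|~: S|%:R.
  move=> /goodP gs; apply: le_trans (opt_hard_network s); case: gs => _ _.
  by apply: le_trans; exact: card_selected_le_weight.
pose M := #|{perm gadget_vertex G}|.
(* Let [a] be the number on the right. A good assignment selects [x] or [y], and both are selected
   equally often, so [#|good| <= a + (a + M - #|good|)]. With [#|good| > 3/5 M] this gives
   [2 a > M / 5]. *)
have half x : x \in S -> (M <= 10 * #|[set s in good | sel s x]|)%N.
  move=> xS; have cx : cluster x = [::] by move: xS; rewrite inE => /eqP.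
  have /card_gt0P[y] : (0 < #|[set y | e x y & cluster y == [:: 0]]|)%N.
    by rewrite card_cadj_root.
  rewrite inE => /andP[xy /eqP cy].
  have [pi [pix piP]] := cluster_view_isomorphism k_gt0 kn cx cy.
  pose tau := gadget_perm pi.
  (* Composition with [tau^-1] permutes the assignments and gives [y] the view that [x] had. *)
  have selE s : sel (tau^-1 * s)%g y = sel s x.
    rewrite -pix; apply: selected_locally_iso.
      by move=> u; rewrite permM permK.
    by move=> p xp sp; apply: piP => //; exact: leq_ltn_trans tk.
  have c1 : #|[set s | sel s y]| = #|[set s | sel s x]|.
    rewrite -(card_imset [set s | sel s x] (mulgI tau^-1%g)).
    apply: eq_card => s; rewrite inE; apply/idP/imsetP => [sy|[s' + ->]].
      by exists (tau * s)%g; rewrite ?inE -?selE ?mulKg.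
    by rewrite inE selE.
  have c2 : (#|good| <= #|[set s in good | sel s x]| + #|[set s | sel s y]|)%N.
    rewrite (leq_trans _ (leq_card_setU _ _)) //; apply: subset_leq_card.
    apply/fintype.subsetP => s sg; apply/finset.setUP.
    by case/orP: (cover s x y sg xy) => selx; [left|right];
      rewrite finset.in_set ?sg.
  have c3 :
      (#|[set s | sel s x]| <= #|[set s in good | sel s x]| + #|~: good|)%N.
    rewrite (leq_trans _ (leq_card_setU _ _)) //; apply: subset_leq_card.
    apply/fintype.subsetP => s; rewrite finset.in_set => selx.
    by rewrite finset.in_setU finset.in_set finset.in_setC selx andbT orbN.
  have := cardsC good; rewrite -/M; move: Hw c1 c2 c3; rewrite -/M; lia.
(* Pairs of a root vertex and a good assignment selecting it are counted in both orders; [cost] then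
   bounds the count by [M * beta * #|~: S|]. *)
have total : (#|S| * M <= 10 * \sum_(s in good) #|[set x in S | sel s x]|)%N.
  apply: (@leq_trans (\sum_(x in S) 10 * #|[set s in good | sel s x]|)%N).
    by rewrite -sum_nat_const leq_sum.
  rewrite -big_distrr leq_mul2l /=.
  under eq_bigr => x _ do rewrite -sum1_card.
  under [leqRHS]eq_bigr => s _ do rewrite -sum1_card.
  rewrite (exchange_big_dep (mem good)) /=; last first.
    by move=> x s _; rewrite inE => /andP[].
  rewrite leq_sum // => s sg; rewrite leq_eqVlt; apply/orP; left; apply/eqP.
  apply: eq_bigl => x.
  by rewrite [X in _ && X]finset.in_set [RHS]finset.in_set sg.
have : (#|S| * M)%:R <= 10 * (M%:R * (beta * #|~: S|%:R)) :> R.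
  apply: le_trans
    (_ : (10 * \sum_(s in good) #|[set x in S | sel s x]|)%:R <= _).
    by rewrite ler_nat.
  rewrite natrM ler_wpM2l // natr_sum.
  apply: le_trans (ler_sum _ cost) _; rewrite sumr_const -[leLHS]mulr_natl.
  by rewrite ler_wpM2r ?mulr_ge0 ?beta_ge0 // ler_nat max_card.
apply/negP; rewrite -ltNge natrM.
have -> : 10 * (M%:R * (beta * #|~: S|%:R)) = 10 * beta * #|~: S|%:R * M%:R.
  by ring.
by rewrite ltr_pM2r ?ltr0n.
Qed.

End Indistinguishability.

(** * Choice of the parameters *)

(** Irrevocable outputs keep a good outcome good, so excluding one number of rounds excludes all
    smaller ones. *)
Lemma approximates_within_mono (R : realType) (A : algorithm R) (G : network R)
    alpha t t' : (t <= t')%N ->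
  approximates_within A G alpha t -> approximates_within A G alpha t'.
Proof.
move=> tt' [E [mE Egood PE]]; exists E; split=> // w /Egood /=.
elim: t' tt' => [|t' IHt]; first by rewrite leqn0 => /eqP->.
rewrite leq_eqVlt => /predU1P[->//|tt'] /(IHt tt')[/forallP term spn cost].
have outE v : output (run (G := G) w t'.+1 v) = output (run (G := G) w t' v).
  have := term v; case E' : (output _) => [ out|//] _.
  by rewrite /=; exact: output_irrevocable.
have selE u v :
    selects (run (G := G) w t'.+1) u v = selects (run (G := G) w t') u v.
  by rewrite /selects outE.
have edgesE :
    output_edges (run (G := G) w t'.+1) = output_edges (run (G := G) w t').
  apply/finset.setP => f; apply/imset2P/imset2P => -[u v uG vs ->];
  by exists u v => //; move: vs; rewrite !finset.inE selE.
by split; rewrite ?edgesE //; apply/forallP => v; rewrite outE.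
Qed.

Section ParameterChoice.
Context (m B : nat).
Hypotheses (m4 : (4 <= m)%N) (B2 : (2 <= B)%N).
(** Thus [delta = k ^ B]. The binary logarithms of the degree and of the size are of order at most
    [m B k] and [m B k ^ 2]; the iterated logarithms cancel the factor [m]. *)
Let k := (2 ^ m)%N.
Let delta := (2 ^ (m * B))%N.

Lemma exp2_gt_id : (m < k)%N. Proof. exact: ltn_expl. Qed.

Lemma base_size_bound :
  (k.+2 ^ k * delta ^ k.*2.+1 <= 2 ^ (5 * m * B * k))%N.
Proof.
have mk := exp2_gt_id.
apply: (@leq_trans (2 ^ (m.+1 * k) * delta ^ k.*2.+1)).
  rewrite leq_mul2r expnM; apply/orP; right.
  have k0 : (0 < k)%N by lia.
  rewrite leq_exp2r // expnS -/k; lia.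
rewrite /delta -expnM -expnD leq_exp2l // -addnn; nia.
Qed.

Lemma degree_bound : (3 * (k.+2 * delta ^ k.+1).+1 <= 2 ^ (m * B * (k + 3)))%N.
Proof.
have mk := exp2_gt_id; have kk : (k * k <= delta)%N.
  by rewrite /k /delta -expnD leq_exp2l //; nia.
have d1 : (0 < delta ^ k.+1)%N by rewrite !expn_gt0.
have -> : (2 ^ (m * B * (k + 3)) = delta ^ k.+1 * (delta * delta))%N.
  by rewrite mulnn expnM -/delta -expnD; congr (_ ^ _)%N; lia.
have k5 : (3 * k.+3 <= delta * delta)%N by nia.
have : (delta ^ k.+1 * (3 * k.+3) <= delta ^ k.+1 * (delta * delta))%N.
  by rewrite leq_mul2l k5 orbT.
nia.
Qed.

Lemma hard_network_exists (R : realType) (A : algorithm R) (alpha : nat -> R)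
    (beta : R) : 0 <= beta ->
  (forall n, (2 ^ (m * B * k) <= n <= 2 ^ (50 * m * B * k ^ 2))%N ->
     alpha n <= beta) ->
  (10 * beta + 1) * k.+1%:R < delta%:R ->
  exists G : network R,
    [/\ (2 ^ (m * B * k) <= max_degree G <= 2 ^ (m * B * (k + 3)))%N,
        (max_degree G <= num_vertices G <= 2 ^ (50 * m * B * k ^ 2))%N
      & requires_rounds A G (alpha (num_vertices G)) k.-1%:R].
Proof.
move=> beta0 alpha_beta hdelta; have mk := exp2_gt_id.
have k0 : (0 < k)%N by lia.
have d0 : (0 < delta)%N by rewrite expn_gt0.
have [|G cG] := @cluster_graph_exists k delta k.*2 _ d0 _ base_size_bound;
  first by nia.
pose n := (3 * #|G|)%N; pose S := root_cluster G.
have SG : (#|S| + #|~: S| = #|G|)%N by exact: cardsC.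
have S0 : (0 < #|S|)%N.
  by apply/card_gt0P; exists (croot G); rewrite inE cluster_root.
have n_le : (n <= 2 ^ (50 * m * B * k ^ 2))%N.
  apply: (@leq_trans (2 ^ 2 * 2 ^ (5 * m * B * k * (4 * k.*2).+1))).
    by rewrite leq_mul.
  by rewrite -expnD leq_exp2l // -addnn expnS expn1; nia.
pose net s := hard_network (alpha n) (G := G) s.
have nE s : num_vertices (net s) = n by exact: num_vertices_gadget.
have deg_ge s : (2 ^ (m * B * k) <= max_degree (net s))%N.
  rewrite expnM -/delta (leq_trans (card_nbrs_root G k0)) //.
  exact: max_degree_gadget_ge.
have deg_le s : (max_degree (net s) <= 2 ^ (m * B * (k + 3)))%N.
  apply: leq_trans degree_bound; apply: max_degree_gadget_le => x.
  exact: card_nbrs_le x d0.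
have deg_n s : (max_degree (net s) <= n)%N.
  by rewrite -(nE s); exact: max_degree_le_num_vertices.
(* From [card_nonroot], [#|~: S| * delta <= k.+1 * (#|S| + #|~: S|)]; the bound on [delta] absorbs
   the second summand. *)
have hS : 10 * Num.max (alpha n) 0 * #|~: S|%:R < #|S|%:R.
  have ab : Num.max (alpha n) 0 <= beta.
    rewrite ge_max beta0 andbT alpha_beta // n_le andbT.
    exact: leq_trans (deg_ge 1%g) (deg_n 1%g).
  apply: (@le_lt_trans _ _ (10 * beta * #|~: S|%:R)).
    by rewrite ler_wpM2r // ler_wpM2l.
  have := card_nonroot G d0; rewrite -SG -(ler_nat R) !natrM natrD.
  have : (0 : R) < #|S|%:R by rewrite ltr0n.
  have : (0 : R) <= #|~: S|%:R by [].
  move: hdelta; have : (0 : R) < k.+1%:R by rewrite ltr0n.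
  move: (#|S|%:R : R) (#|~: S|%:R : R) (delta%:R : R) (k.+1%:R : R) => a b d l.
  move=> l0 dl b0 a0 bd; have [->|b1] := eqVneq b 0; first by rewrite mulr0.
  have {b0 b1} b0 : 0 < b by rewrite lt_def b1.
  have : b * ((10 * beta + 1) * l) < b * d by rewrite ltr_pM2l.
  rewrite -(ltr_pM2l l0); nra.
have [||s sP] :=
  @hard_network_lower_bound R k delta k.*2 G A (alpha n) k.-2 k0 _ _ hS.
- by rewrite leqW // leqW.
- lia.
exists (net s); split; rewrite ?nE ?deg_ge ?deg_le ?deg_n //.
move=> t At; rewrite ler_nat leqNgt; apply/negP => tk; apply: sP.
apply: approximates_within_mono At; lia.
Qed.

End ParameterChoice.

Lemma ln2_bounds (R : realType) : 1 / 2 <= (ln 2 : R) <= 1.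
Proof.
have e1 : 1 + (- (1 / 2)) <= expR (- (1 / 2)) :> R by exact: expR_ge1Dx.
have e2 : 1 + 1 <= expR 1 :> R by exact: expR_ge1Dx.
apply/andP; split; last by rewrite -ler_expR lnK ?posrE //; lra.
rewrite -ler_expR lnK ?posrE // -[X in X <= _]invrK -expRN.
rewrite -[leRHS]invrK lef_pV2 ?posrE ?invr_gt0 ?expR_gt0 //; lra.
Qed.

Lemma ln_exp2 (R : realType) a : ln (2 ^ a)%:R = a%:R * ln 2 :> R.
Proof. by rewrite natrX lnXn // mulr_natl. Qed.

(** The lower bound on [x] gives [ln x >= 2 ^ m], as [m * B * ln 2 >= 1], hence
    [ln (ln x) >= m * ln 2]; the upper bound gives [ln x <= Z * ln 2]. *)
Lemma ln_ratio_le (R : realType) m B Z x : (4 <= m)%N -> (2 <= B)%N ->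
  (2 ^ (m * B * 2 ^ m) <= x <= 2 ^ Z)%N ->
  ln x%:R / ln (ln x%:R) <= Z%:R / m%:R :> R.
Proof.
move=> m4 B2 /andP[lx ux]; have /andP[L0 L1] := ln2_bounds R.
have lnx_le : ln x%:R <= Z%:R * ln 2 :> R.
  rewrite -ln_exp2 ler_ln ?posrE ?ltr0n ?expn_gt0 ?ler_nat //.
  by rewrite (leq_trans _ lx) // expn_gt0.
have x0 : (0 < x)%N by rewrite (leq_trans _ lx) // expn_gt0.
have lnx_ge : (2 ^ m)%:R <= ln x%:R :> R.
  apply: (@le_trans _ _ ((m * B * 2 ^ m)%:R * ln 2)).
    rewrite natrM; have : (8 : R) <= (m * B)%:R by rewrite ler_nat; nia.
    have : (0 : R) < (2 ^ m)%:R by rewrite ltr0n expn_gt0.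
    move: ((m * B)%:R : R) ((2 ^ m)%:R : R) => a b b0 a8.
    by rewrite mulrAC ler_peMl ?ltW //; nra.
  by rewrite -ln_exp2 ler_ln ?posrE ?ltr0n ?expn_gt0 ?ler_nat.
have lnlnx : m%:R * ln 2 <= ln (ln x%:R) :> R.
  rewrite -ln_exp2 ler_ln ?posrE ?ltr0n ?expn_gt0 //.
  by rewrite (lt_le_trans _ lnx_ge) // ltr0n expn_gt0.
have m0 : (0 : R) < m%:R by rewrite ltr0n; lia.
have mL : (0 : R) < m%:R * ln 2 by rewrite mulr_gt0 //; lra.
rewrite ler_pdivrMr ?(lt_le_trans mL) //.
apply: le_trans lnx_le _; rewrite mulrAC ler_pdivlMr //.
by rewrite -mulrA [ln 2 * _]mulrC ler_wpM2l.
Qed.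

(** Since [m < 2 ^ m], [ln n] is at most [50 * B] times the cube of [2 ^ m]. *)
Lemma polylog_bound (R : realType) (C : R) c m B n : (4 <= m)%N -> (2 <= B)%N ->
  (0 < n <= 2 ^ (50 * m * B * (2 ^ m) ^ 2))%N ->
  C * ln n%:R ^+ c <= `|C| * (50 * B)%:R ^+ c * (2 ^ m)%:R ^+ (3 * c).
Proof.
move=> m4 B2 /andP[n0 nle]; have /andP[L0 L1] := ln2_bounds R.
have ln0 : 0 <= ln n%:R :> R by rewrite ln_ge0 // ler1n.
apply: (@le_trans _ _ (`|C| * ln n%:R ^+ c)).
  by rewrite ler_wpM2r ?exprn_ge0 // ler_norm.
rewrite -mulrA ler_wpM2l // exprM -exprMn lerXn2r ?nnegrE //.
apply: (@le_trans _ _ ((50 * m * B * (2 ^ m) ^ 2)%:R * ln 2)).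
  by rewrite -ln_exp2 ler_ln ?posrE ?ltr0n ?expn_gt0 ?ler_nat.
apply: (@le_trans _ _ (50 * m * B * (2 ^ m) ^ 2)%:R).
  by rewrite ler_piMr.
rewrite -natrX -natrM ler_nat; have mk : (m < 2 ^ m)%N by exact: ltn_expl.
have : (50 * B * (2 ^ m) ^ 2 * m <= 50 * B * (2 ^ m) ^ 2 * 2 ^ m)%N.
  by rewrite leq_mul2l ltnW ?orbT.
by rewrite (expnSr _ 2) !mulnA; lia.
Qed.

Theorem theorem16 (R : realType) (alpha : nat -> R)
    (halpha : polylogarithmic alpha) :
  exists delta : R, 0 < delta /\
    forall A : algorithm R, has_approximation_ratio A alpha ->
      (forall N : nat, exists G : network R,
          (N <= max_degree G)%N /\
          requires_rounds A G (alpha (num_vertices G))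
            (delta * (ln (max_degree G)%:R / ln (ln (max_degree G)%:R)))) /\
      (forall N : nat, exists G : network R,
          (N <= num_vertices G)%N /\
          requires_rounds A G (alpha (num_vertices G))
            (delta * Num.sqrt (ln (num_vertices G)%:R /
                                ln (ln (num_vertices G)%:R)))).
Proof.
have [c [C [N0 _ HC]]] := halpha.
(* With [k = 2 ^ m], of the factors in [k ^ B], [3 * c] absorb the ratio, one absorbs [k + 1] and
   one the constant [2 * (10 * K + 1)]. *)
pose B := (3 * c + 2)%N; have B2 : (2 <= B)%N by rewrite leq_addl.
pose K : R := `|C| * (50 * B)%:R ^+ c.
have K0 : 0 <= K by rewrite mulr_ge0 // exprn_ge0.
have Bpos : (0 : R) < B%:R by rewrite ltr0n; lia.
(* Both expressions will be at most [50 * B * k], and [k <= 2 * (k - 1)]. *)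
exists (100 * B%:R)^-1; split; first by rewrite invr_gt0 mulr_gt0.
move=> A _.
(* The same networks serve both bounds. *)
have hard N : exists m (G : network R), [/\ (4 <= m)%N, (N <= max_degree G)%N,
    (2 ^ (m * B * 2 ^ m) <= max_degree G <= 2 ^ (m * B * (2 ^ m + 3)))%N,
    (max_degree G <= num_vertices G <= 2 ^ (50 * m * B * (2 ^ m) ^ 2))%N
    & requires_rounds A G (alpha (num_vertices G)) (2 ^ m).-1%:R].
  have [m [m4 Nm N0m boundm]] : exists m, [/\ 4 <= m, N <= m, N0 <= m
      & Num.bound (2 * (10 * K + 1)) <= m]%N.
    by exists (4 + N + N0 + Num.bound (2 * (10 * K + 1)))%N; split; lia.
  have mk : (m < 2 ^ m)%N by exact: ltn_expl.
  have k_big : 2 * (10 * K + 1) < (2 ^ m)%:R.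
    apply: lt_le_trans (archi_boundP _) _.
      by rewrite mulr_ge0 // addr_ge0 // mulr_ge0.
    by rewrite ler_nat ltnW // (leq_ltn_trans boundm).
  have mX : (m <= 2 ^ (m * B * 2 ^ m))%N.
    apply: leq_trans (ltnW mk) _; rewrite leq_exp2l // -mulnA.
    by rewrite leq_pmulr // muln_gt0 expn_gt0 /= (leq_trans _ B2).
  have beta0 : 0 <= K * (2 ^ m)%:R ^+ (3 * c) by rewrite mulr_ge0 // exprn_ge0.
  have [n /andP[n_ge n_le]||G [Ddeg Dn req]] :=
      @hard_network_exists m B m4 B2 R A alpha _ beta0.
  - apply: le_trans (HC n _) _; first exact: leq_trans (leq_trans N0m mX) n_ge.
    apply: polylog_bound => //.
    by rewrite n_le andbT (leq_trans _ n_ge) ?expn_gt0.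
  - have k1 : (1 : R) <= (2 ^ m)%:R by rewrite ler1n expn_gt0.
    have kS : (2 ^ m).+1%:R <= 2 * (2 ^ m)%:R :> R.
      by rewrite -natrM ler_nat; lia.
    have X1 : 1 <= (2 ^ m)%:R ^+ (3 * c) :> R by rewrite exprn_ege1.
    rewrite [ltRHS](_ : _ =
      (2 ^ m)%:R ^+ (3 * c) * (2 ^ m)%:R * (2 ^ m)%:R); last first.
      by rewrite -exprSr -exprSr -natrX -expnM /B addn2.
    have l0 : (0 : R) <= (2 ^ m).+1%:R by [].
    move: K0 k_big k1 kS X1 l0.
    move: ((2 ^ m).+1%:R : R) ((2 ^ m)%:R : R) => l x.
    move: (x ^+ (3 * c)) => X K0 kb x1 lx X1 l0.
    have X0 : 0 < X by exact: lt_le_trans X1.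
    have x0 : 0 < x by exact: lt_le_trans x1.
    apply: (@le_lt_trans _ _ ((10 * K + 1) * X * (2 * x))).
      apply: ler_pM => //.
        by rewrite addr_ge0 // mulr_ge0 // mulr_ge0 // ltW.
      rewrite (_ : (10 * K + 1) * X = 10 * (K * X) + X); last by ring.
      by rewrite lerD2l.
    rewrite [ltLHS](_ : _ = X * x * (2 * (10 * K + 1))); last by ring.
    by rewrite ltr_pM2l // mulr_gt0.
  exists m, G; split=> //.
  by case/andP: Ddeg => [/(leq_trans mX) + _]; exact: leq_trans.
have small m x (G : network R) : (4 <= m)%N -> x <= 50 * B%:R * (2 ^ m)%:R ->
    requires_rounds A G (alpha (num_vertices G)) (2 ^ m).-1%:R ->
    requires_rounds A G (alpha (num_vertices G)) ((100 * B%:R)^-1 * x).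
  move=> m4 xle req t /req; apply: le_trans.
  rewrite ler_pdivrMl ?mulr_gt0 //; apply: le_trans xle _.
  have : (2 ^ m)%:R <= 2 * (2 ^ m).-1%:R :> R.
    have mk : (m < 2 ^ m)%N by exact: ltn_expl.
    by rewrite -natrM ler_nat; lia.
  by move: ((2 ^ m)%:R : R) ((2 ^ m).-1%:R : R) => a b ab; nra.
split=> N; have [m [G [m4 ND Ddeg /andP[Dn nX] req]]] := hard N; exists G;
  have mR : (0 : R) < m%:R by rewrite ltr0n; lia.
  split=> //; apply: small req => //.
  apply: le_trans (ln_ratio_le R m4 B2 Ddeg) _.
  rewrite ler_pdivrMr // -!natrM ler_nat.
  have mk : (m < 2 ^ m)%N by exact: ltn_expl.
  nia.
split; first exact: leq_trans Dn.
apply: small req => //.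
have nP : (2 ^ (m * B * 2 ^ m) <= num_vertices G
             <= 2 ^ (50 * m * B * (2 ^ m) ^ 2))%N.
  by rewrite nX andbT; case/andP: Ddeg => + _ => /leq_trans; apply.
have y0 : 0 <= 50 * B%:R * (2 ^ m)%:R :> R by rewrite !mulr_ge0.
(* Under the root the ratio is at most [50 * B * k ^ 2], which is below the square of
   [50 * B * k]. *)
rewrite -[leRHS](ger0_norm y0) -sqrtr_sqr ler_wsqrtr //.
apply: le_trans (ln_ratio_le R m4 B2 nP) _.
rewrite ler_pdivrMr // -!natrM -natrX -natrM ler_nat.
by move: (2 ^ m)%N => k; nia.
Qed.
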